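(* Suppose $\beta_n>0$ for all $n=1,\dots,N$, let $\ell\in F_\epsilon'$ be SPSD, and assume that the temporal mesh is uniform. Then the discrete solution $U^k\in E^k_\pi$ to $$\mathcal{B}^k(U^k,v)=\ell(v)\quad\forall v\in F^k_\epsilon$$ satisfies the stability bound $$\|U^k\|_\pi\le C_k\,\|\ell\|_{-\epsilon}\quad\text{with}\quad C_k:=\gamma_k^{-2}\,\beta\left(1+(\alpha-\theta^2)\frac{\alpha^{N-1}-1}{\alpha-1}\right),$$ where $\gamma_k$ is the discrete inf-sup constant of $b$ on $E^k\times F^k$. If $\alpha=1$ then $C_k=\gamma_k^{-2}\beta\,(\theta^2+N(1-\theta^2))$.
   Context: Let $T>0$, $J=(0,T)$, $\lambda>0$, $\rho\ge0$. $E = L_2(J)$ with $\|w\|_E^2 := \lambda \|w\|_{L_2(J)}^2$; $F = \{v\in H^1(J): v(T)=0\}$ with $\|v\|_F^2 := \lambda^{-1}\|v'\|_{L_2(J)}^2 + \lambda\|v\|_{L_2(J)}^2 + |v(0)|^2$. $b(w,v) := \int_J w(-v'+\lambda v)\,dt$ on $E\times F$. $E_\pi=E\otimes_\pi E$ is the projective and $F_\epsilon=F\otimes_\epsilon F$ the injective tensor product, with norms $\|\cdot\|_\pi$, $\|\cdot\|_\epsilon$; $\|\cdot\|_{-\epsilon}$ is the norm of the dual $F_\epsilon'$. $B$ is the unique continuous bilinear form on $E_\pi\times F_\epsilon$ with $B(w_1\otimes w_2,v_1\otimes v_2)=b(w_1,v_1)b(w_2,v_2)$. A function $w\in L_2(J\times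 J)$ is SPSD if it is symmetric and $\int_J\int_Jw(s,t)\varphi(s)\varphi(t)\,ds\,dt\ge0$ for all $\varphi\in L_2(J)$. A functional $\ell\in F_\epsilon'$ is SPSD if $\ell(\psi\otimes\tilde\psi)=\ell(\tilde\psi\otimes\psi)$ and $\ell(\psi\otimes\psi)\ge0$ for all $\psi,\tilde\psi\in F$. Mesh $0=t_0<\dots<t_N=T$, $J_n=(t_{n-1},t_n)$, $k_n=t_n-t_{n-1}$. $F^k\subset F$: continuous functions affine on each $J_n$, vanishing at $T$, with hat basis $\{v_i\}_{0\le i\le N-1}$, $v_i(t_j)=\delta_{ij}$. $E^k=\operatorname{span}\{e_n\}_{1\le n\le N}\subset E$, $e_n$ supported on $\overline{J_n}$ and on $J_n$ a nonzero multiple of either the constant $1$ ($\text{CN}^\star$) or $t\mapsto4-6(t-t_{n-1})/k_n$ ($\text{iE}^\star$), the same choice for all $n$. With $S(\cdot)$ denoting unit spheres, it is assumed that $\gamma_k:=\inf_{w\in S(E^k)}\sup_{v\in S(F^k)}b(w,v)>0$. $E^k_\pi=E^k\otimes E^k\subset E_\pi$, $F^k_\epsilon=F^k\otimes F^k\subset F_\epsilon$. $\Delta^k:E_\pi\times F_\epsilon\to\mathbb{R}$ is a bilinear, continuous form such that: (i) for every SPSD $w\in E^k_\pi$, $\Delta^k(w,\psi\otimes\tilde\psi)=\Delta^k(w,\tilde\psi\otimes\psi)$ and $\Delta^k(w,\psi\otimes\psi)\ge0$ for all $\psi,\tilde\psi\in F^k$; (ii) $\Delta^k(e_m\otimes e_n,v_i\otimes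 v_j)\neq0$ only if $m=n$ and $i,j\in\{n-1,n\}$. $\mathcal{B}^k:=B-\rho^2\Delta^k$. $b_{in}:=b(e_n,v_i)$ (then $b_{n-1,n}\ne0$); $\Delta^n_{11}:=\Delta^k(e_n\otimes e_n,v_{n-1}\otimes v_{n-1})$ for $1\le n\le N$, and for $1\le n\le N-1$, $\Delta^n_{12}:=\Delta^k(e_n\otimes e_n,v_{n-1}\otimes v_n)$, $\Delta^n_{22}:=\Delta^k(e_n\otimes e_n,v_n\otimes v_n)$. Define $\beta_n:=(1-\rho^2b_{n-1,n}^{-2}\Delta^n_{11})^{-1}$ and, for $n\ge2$, $\theta_n:=b_{n-1,n}^{-1}b_{n-1,n-1}$, $\alpha_n:=\beta_n[\theta_n^2+\rho^2b_{n-1,n}^{-2}(\Delta^{n-1}_{22}-2b_{n-2,n-1}^{-1}b_{n-1,n-1}\Delta^{n-1}_{12})]$. ($\beta_n>0$ means $1-\rho^2b_{n-1,n}^{-2}\Delta^n_{11}>0$; under this condition the discrete problem has a unique solution.) For the uniform mesh the basis is scaled so that $\|e_n\|_E=1$ (with the $e_n$ translates of one another), and then $(\alpha,\beta,\theta):=(\alpha_n,\beta_n,\theta_n)$ do not depend on $n$. If $N=1$ the summand with $\alpha^{N-1}-1$ is read as zero. *)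

(* Defs.v *)
From HB Require Import structures.
From mathcomp Require Import all_boot all_order all_algebra.
From mathcomp Require Import all_classical all_reals all_analysis.
From mathcomp Require Import measurable_realfun ring lra.

Set Implicit Arguments.
Unset Strict Implicit.
Unset Printing Implicit Defensive.
Import Order.TTheory GRing.Theory Num.Theory.
Import numFieldNormedType.Exports.

Local Open Scope classical_set_scope.
Local Open Scope quotient_scope.
Local Open Scope ring_scope.

Section L2.
Context d (T : measurableType d) (R : realType).
Variable mu : {measure set T -> \bar R}.
Notation Lfun2 := (LfunType mu (lee1n 2)).

Definition ae0 : {pred Lfun2} := [pred f : Lfun2 | `[< f = cst 0 %[ae mu] >] ].

Lemma ae0P (f : Lfun2) : reflect (f = cst 0 %[ae mu]) (f \in ae0).
Proof. exact: asboolP. Qed.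

Lemma ae0_zmod_closed : zmod_closed ae0.
Proof.
split; first by apply/ae0P/aeW.
move=> f g /ae0P f0 /ae0P g0; apply/ae0P.
by apply: filterS2 f0 g0 => x /= fx gx _; rewrite !fctE fx// gx// subr0.
Qed.
HB.instance Definition _ := GRing.isZmodClosed.Build Lfun2 ae0 ae0_zmod_closed.

(* L_2(mu): square integrable functions modulo equality a.e.; the library
   has no vector space structure on its LspaceType. *)
Definition L2 : Type := Quotient.quot ae0.
HB.instance Definition _ := EqQuotient.on L2.
HB.instance Definition _ := GRing.Zmodule.on L2.
Definition L2_fun (f : L2) : T -> R := repr f.
Arguments L2_fun : simpl never.


Lemma L2_eqP (f g : Lfun2) :
  \pi_L2 f = \pi_L2 g <-> (f : T -> R) = g %[ae mu].
Proof.
have -> : (\pi_L2 f = \pi_L2 g) <-> (f - g) \in ae0.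
  by rewrite Quotient.idealrBE; split => [->//|/eqP].
split => [/ae0P|] fg; last apply/ae0P.
  apply: filterS fg => x /= /(_ I); rewrite !fctE => /eqP.
  by rewrite subr_eq0 => /eqP.
by apply: filterS fg => x /= /(_ I); rewrite !fctE => -> _; rewrite subrr.
Qed.

Lemma L2_funK (f : Lfun2) : L2_fun (\pi_L2 f) = f %[ae mu].
Proof. by apply/L2_eqP; rewrite reprK. Qed.

Lemma L2_funP (f g : L2) : f = g <-> L2_fun f = L2_fun g %[ae mu].
Proof. by split=> [->|/L2_eqP]; [exact: aeW|rewrite !reprK]. Qed.

Lemma L2_Lfun (f : L2) : L2_fun f \in Lfun mu 2%:E.
Proof. exact: LfunP. Qed.

Lemma L2_funD (f g : L2) : L2_fun (f + g) = (L2_fun f \+ L2_fun g) %[ae mu].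
Proof.
have -> : f + g = \pi_L2 (repr f + repr g) by rewrite Quotient.pi_add !reprK.
exact: L2_funK.
Qed.

Definition L2_scale (a : R) (f : L2) : L2 := \pi_L2 (a *: repr f).

Lemma L2_funZ_subproof a (f : L2) :
  L2_fun (L2_scale a f) = (fun x => a * L2_fun f x) %[ae mu].
Proof. exact: L2_funK. Qed.

Lemma L2_scaleA a b f : L2_scale a (L2_scale b f) = L2_scale (a * b) f.
Proof.
apply/L2_funP.
apply: filterS3 (L2_funZ_subproof a (L2_scale b f)) (L2_funZ_subproof b f)
  (L2_funZ_subproof (a * b) f) => x fx gx hx _.
by rewrite fx// gx// hx// mulrA.
Qed.

Lemma L2_scale1 : left_id 1 L2_scale.
Proof. by move=> f; rewrite /L2_scale scale1r reprK. Qed.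

Lemma L2_scaleDr : right_distributive L2_scale +%R.
Proof.
move=> a f g; apply/L2_funP.
have := L2_funZ_subproof a (f + g); have := L2_funD f g.
have := L2_funD (L2_scale a f) (L2_scale a g).
have := L2_funZ_subproof a f; have := L2_funZ_subproof a g.
move=> ae1 ae2 ae3 ae4 ae5.
apply: (filterS _ (filterI (filterI ae1 ae2) (filterI ae3 (filterI ae4 ae5)))).
move=> x [[h4 h3] [h5 [h2 h1]]] _.
by rewrite h5// h1// h2//= h3// h4// mulrDr.
Qed.

Lemma L2_scaleDl f : {morph L2_scale^~ f : a b / a + b}.
Proof.
move=> a b; apply/L2_funP.
have := L2_funZ_subproof (a + b) f.
have := L2_funD (L2_scale a f) (L2_scale b f).
have := L2_funZ_subproof a f; have := L2_funZ_subproof b f.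
move=> ae1 ae2 ae3 ae4.
apply: (filterS _ (filterI (filterI ae1 ae2) (filterI ae3 ae4))).
move=> x [[h4 h3] [h5 h1]] _.
by rewrite h5// h1//= h3// h4// mulrDl.
Qed.

HB.instance Definition _ := GRing.Zmodule_isLmodule.Build R L2
  L2_scaleA L2_scale1 L2_scaleDr L2_scaleDl.

Lemma L2_funZ a (f : L2) : L2_fun (a *: f) = (fun x => a * L2_fun f x) %[ae mu].
Proof. exact: L2_funZ_subproof. Qed.

Definition L2norm (f : T -> R) : R := fine ('N[mu]_2%:E[EFin \o f])%E.

Lemma ae_L2norm (f g : T -> R) : measurable_fun setT f -> measurable_fun setT g ->
  f = g %[ae mu] -> L2norm f = L2norm g.
Proof.
move=> mf mg fg; rewrite /L2norm unlock /=; congr (fine (_ `^ _)%E).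
apply: ae_eq_integral => //.
- apply/measurable_EFinP; apply: (measurableT_comp (measurable_powR _)).
  exact: measurableT_comp.
- apply/measurable_EFinP; apply: (measurableT_comp (measurable_powR _)).
  exact: measurableT_comp.
- by apply: filterS fg => x /= /[apply] ->.
Qed.

Lemma L2_measurable (f : L2) : measurable_fun setT (L2_fun f).
Proof. exact: measurable_funPT. Qed.

Lemma L2norm_ge0 (f : T -> R) : 0 <= L2norm f.
Proof. by rewrite /L2norm fine_ge0// Lnorm_ge0. Qed.

Lemma ler_L2normD_Lfun (f g : T -> R) : f \in Lfun mu 2%:E -> g \in Lfun mu 2%:E ->
  L2norm (f \+ g) <= L2norm f + L2norm g.
Proof.
move=> fL gL; rewrite -(Lfun_valP (lee1n 2) fL) -(Lfun_valP (lee1n 2) gL).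
exact: ler_LnormD.
Qed.

Lemma L2normZ_Lfun a (f : T -> R) : f \in Lfun mu 2%:E ->
  L2norm (fun x => a * f x) = `|a| * L2norm f.
Proof.
move=> fL; rewrite -(Lfun_valP (lee1n 2) fL) /L2norm.
rewrite [X in fine X](LnormZ (Lfun_Sub (lee1n 2) fL) a) fineM//.
by rewrite -finite_norm_fine.
Qed.

Lemma ler_L2normD (f g : L2) :
  L2norm (L2_fun (f + g)) <= L2norm (L2_fun f) + L2norm (L2_fun g).
Proof.
rewrite (ae_L2norm _ _ (L2_funD f g)); first last.
- by apply: measurable_funD; exact: L2_measurable.
- exact: L2_measurable.
- by apply: ler_L2normD_Lfun; exact: L2_Lfun.
Qed.

Lemma L2normZ a (f : L2) : L2norm (L2_fun (a *: f)) = `|a| * L2norm (L2_fun f).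
Proof.
rewrite (ae_L2norm _ _ (L2_funZ a f)); first last.
- by apply: measurable_funM => //; exact: L2_measurable.
- exact: L2_measurable.
- by apply: L2normZ_Lfun; exact: L2_Lfun.
Qed.

Lemma L2norm_eq0 (f : L2) : L2norm (L2_fun f) = 0 -> f = 0.
Proof.
move=> /fine_Lnormr_eq0 f0; apply/L2_funP.
have h := L2_funZ 0 0; rewrite scale0r in h.
by apply: (filterS _ (filterI f0 h)) => x [fx hx] _; rewrite hx// mul0r; exact: fx.
Qed.
End L2.

Section J.
Variables (R : realType) (T : R).

Lemma itv_ltey : ((@lebesgue_measure R) `]0%R, T[%classic < +oo)%E.
Proof. by rewrite lebesgue_measure_itv/=; case: ifP => //; rewrite ltry. Qed.

(* Lebesgue measure on J = (0, T), as a finite measure on the real line. *)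
Definition muJ : set (measurableTypeR R) -> \bar R :=
  @mfrestr _ (measurableTypeR R) R `]0, T[%classic lebesgue_measure
    (measurable_itv `]0, T[) itv_ltey.
HB.instance Definition _ := FiniteMeasure.on muJ.
End J.

Section L2_integral.
Context d (T : measurableType d) (R : realType).
Variable mu : {finite_measure set T -> \bar R}.

Lemma L2_integrable (D : set T) (f : L2 mu) : measurable D ->
  mu.-integrable D (EFin \o L2_fun f).
Proof.
move=> mD; apply: (@integrableS _ _ _ mu setT) => //.
apply/Lfun1_integrable; apply: Lfun_subset12; last exact: L2_Lfun.
exact: fin_num_measure.
Qed.

Lemma L2_RintegralZD (D : set T) a (f g : L2 mu) : measurable D ->
  \int[mu]_(x in D) L2_fun (a *: f + g) x =
  a * \int[mu]_(x in D) L2_fun f x + \int[mu]_(x in D) L2_fun g x.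
Proof.
move=> mD; have If := L2_integrable f mD; have Ig := L2_integrable g mD.
rewrite -RintegralZl// -RintegralD//; last first.
  rewrite (_ : _ \o _ = fun x => a%:E * (EFin \o L2_fun f) x)%E.
    exact: integrableZl.
  by apply/funext => x; rewrite /= EFinM.
congr fine; apply: ae_eq_integral => //.
- by apply/measurable_EFinP; apply: measurable_funTS; exact: L2_measurable.
- apply/measurable_EFinP; apply: measurable_funTS.
  apply: measurable_funD; last exact: L2_measurable.
  by apply: measurable_funM => //; exact: L2_measurable.
- apply: (filterS _ (filterI (L2_funD (a *: f) g) (L2_funZ a f))).
  by move=> x [/(_ I)fgx /(_ I)fx] _ /=; rewrite fgx /= fx.
Qed.
End L2_integral.

(* E = L_2(J); the weight lambda of the norm is a parameter of the type. *)
Definition Espace (R : realType) (lambda : {posnum R}) (T : R) : Type :=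
  L2 (muJ T).

Section E.
Variables (R : realType) (lambda : {posnum R}) (T : R).
Notation E := (Espace lambda T).

HB.instance Definition _ := GRing.Lmodule.on E.
Definition E_fun (w : E) : R -> R := L2_fun w.

Definition normE (w : E) : R :=
  Num.sqrt lambda%:num * L2norm (muJ T) (E_fun w).

Lemma ler_normED w1 w2 : normE (w1 + w2) <= normE w1 + normE w2.
Proof. by rewrite /normE -mulrDr ler_wpM2l// ler_L2normD. Qed.

Lemma normEZ a w : normE (a *: w) = `|a| * normE w.
Proof. by rewrite /normE L2normZ mulrCA. Qed.

Lemma normE_eq0 w : normE w = 0 -> w = 0.
Proof.
move/eqP; rewrite mulf_eq0 gt_eqF/= ?sqrtr_gt0// => /eqP; exact: L2norm_eq0.
Qed.

HB.instance Definition _ := Lmodule_isNormed.Build R E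
  ler_normED normEZ normE_eq0.
End E.

Lemma minkowski3 (R : realType) (p q a1 a2 a3 b1 b2 b3 : R) : 0 < p -> 0 < q ->
  Num.sqrt (p * (a1 + b1) ^+ 2 + q * (a2 + b2) ^+ 2 + (a3 + b3) ^+ 2) <=
  Num.sqrt (p * a1 ^+ 2 + q * a2 ^+ 2 + a3 ^+ 2) +
  Num.sqrt (p * b1 ^+ 2 + q * b2 ^+ 2 + b3 ^+ 2).
Proof.
move=> p0 q0.
set A := p * a1 ^+ 2 + _ + _; set B := p * b1 ^+ 2 + _ + _.
have pos r s x y z : 0 <= r -> 0 <= s -> 0 <= r * x ^+ 2 + s * y ^+ 2 + z ^+ 2 :> R.
  by move=> r0 s0; apply: addr_ge0; [apply: addr_ge0; exact: mulr_ge0 (sqr_ge0 _)|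
                                     exact: sqr_ge0].
have A0 : 0 <= A by apply: pos; exact: ltW.
have B0 : 0 <= B by apply: pos; exact: ltW.
pose C := p * a1 * b1 + q * a2 * b2 + a3 * b3.
have CAB : C <= Num.sqrt A * Num.sqrt B.
  rewrite -sqrtrM// (le_trans (ler_norm _))// -sqrtr_sqr ler_wsqrtr//.
  rewrite -subr_ge0 (_ : _ - _ = p * q * (a1 * b2 - a2 * b1) ^+ 2 +
    p * (a1 * b3 - a3 * b1) ^+ 2 + q * (a2 * b3 - a3 * b2) ^+ 2).
    apply: addr_ge0; last exact: mulr_ge0 (ltW q0) (sqr_ge0 _).
    apply: addr_ge0; last exact: mulr_ge0 (ltW p0) (sqr_ge0 _).
    exact: mulr_ge0 (mulr_ge0 (ltW p0) (ltW q0)) (sqr_ge0 _).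
  by rewrite /A /B /C; ring.
have {}CAB : 2 * C <= 2 * (Num.sqrt A * Num.sqrt B) by rewrite ler_pM2l.
rewrite -[leRHS]ger0_norm ?addr_ge0 ?sqrtr_ge0// -[leRHS]sqrtr_sqr ler_wsqrtr//.
rewrite [leRHS]sqrrD !sqr_sqrtr// -mulr_natl.
rewrite (_ : p * (a1 + b1) ^+ 2 + _ + _ = A + 2 * C + B).
  by rewrite lerD2r lerD2l.
by rewrite /A /B /C; ring.
Qed.

Lemma sumsq3_le0 (R : realType) (p q a b c : R) : 0 < p -> 0 < q ->
  p * a ^+ 2 + q * b ^+ 2 + c ^+ 2 <= 0 -> a = 0.
Proof.
move=> p0 q0 h.
have h1 : 0 <= p * a ^+ 2 by rewrite mulr_ge0 ?sqr_ge0// ltW.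
have h2 : 0 <= q * b ^+ 2 by rewrite mulr_ge0 ?sqr_ge0// ltW.
have h3 : 0 <= c ^+ 2 by rewrite sqr_ge0.
have /eqP : p * a ^+ 2 = 0 by lra.
by rewrite mulf_eq0 gt_eqF//= sqrf_eq0 => /eqP.
Qed.

(* The graph of v |-> v' on {v in H^1(J) : v(T) = 0}: pairs (v, v') with v the absolutely
   continuous representative and v' the weak derivative, both in L_2(J).  The
   identity holds for all reals s <= t, so v is also pinned down outside J,
   where it is constant. *)
Definition Fgraph (R : realType) (T : R) : {pred (R -> R) * L2 (muJ T)} :=
  [pred p : (R -> R) * L2 (muJ T) | `[<
  [/\ p.1 \in Lfun (muJ T) 2%:E,
      forall s t, s <= t ->
        p.1 t - p.1 s = \int[muJ T]_(x in `]s, t]) L2_fun p.2 x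
    & p.1 T = 0] >] ].
Arguments Fgraph {R} T.

Definition Fspace (R : realType) (lambda : {posnum R}) (T : R) : Type :=
  {p : (R -> R) * L2 (muJ T) | p \in Fgraph T}.

Section F.
Variables (R : realType) (lambda : {posnum R}) (T : R).
Notation mu := (muJ T).
Notation F := (Fspace lambda T).

Lemma FgraphP (p : (R -> R) * L2 mu) :
  reflect [/\ p.1 \in Lfun mu 2%:E,
      forall s t, s <= t -> p.1 t - p.1 s = \int[mu]_(x in `]s, t]) L2_fun p.2 x
    & p.1 T = 0] (p \in Fgraph T).
Proof. exact: asboolP. Qed.

Lemma Fgraph_submod_closed : submod_closed (Fgraph T).
Proof.
have hD a (p q : (R -> R) * L2 mu) : p \in Fgraph T -> q \in Fgraph T ->
    a *: p + q \in Fgraph T.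
  move=> /FgraphP[p2 pI pT] /FgraphP[q2 qI qT]; apply/FgraphP; split => [|s t st|].
  - exact: (Lfun_submod_closed mu (lee1n 2)).2.
  - rewrite L2_RintegralZD; last exact: measurable_itv.
    rewrite -pI// -qI//.
    have pqE x : (a *: p + q).1 x = a * p.1 x + q.1 x by [].
    by rewrite !pqE; ring.
  - have -> : (a *: p + q).1 T = a * p.1 T + q.1 T by [].
    by rewrite pT qT mulr0 addr0.
split; last exact: hD.
apply/FgraphP; split => [|s t st|//].
- exact: (Lfun_submod_closed mu (lee1n 2)).1.
- have := L2_RintegralZD (-1) (0 : L2 mu) 0 (measurable_itv `]s, t]).
  by rewrite scaler0 addr0 mulN1r addNr => ->; rewrite subrr.
Qed.
HB.instance Definition _ := GRing.isSubmodClosed.Build R _ (Fgraph T) Fgraph_submod_closed.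

HB.instance Definition _ := SubChoice.on F.
HB.instance Definition _ := [SubChoice_isSubLmodule of F by <:].

Definition F_fun (v : F) : R -> R := (val v).1.
Definition F_deriv (v : F) : R -> R := L2_fun (val v).2.

Definition normF (v : F) : R :=
  Num.sqrt (lambda%:num^-1 * L2norm mu (F_deriv v) ^+ 2
            + lambda%:num * L2norm mu (F_fun v) ^+ 2 + F_fun v 0 ^+ 2).

Lemma F_Lfun (v : F) : F_fun v \in Lfun mu 2%:E.
Proof. by case/FgraphP: (valP v). Qed.

Lemma F_funD (v w : F) x : F_fun (v + w) x = F_fun v x + F_fun w x.
Proof. by []. Qed.

Lemma F_funZ a (v : F) x : F_fun (a *: v) x = a * F_fun v x.
Proof. by []. Qed.

Lemma ler_normFD v w : normF (v + w) <= normF v + normF w.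
Proof.
apply: le_trans (minkowski3 _ _ _ _ _ _ _ _); rewrite ?invr_gt0//.
apply: ler_wsqrtr; rewrite lerD// lerD//.
- rewrite ler_wpM2l ?invr_ge0// lerXn2r ?nnegrE ?addr_ge0 ?L2norm_ge0//.
  exact: ler_L2normD.
- rewrite ler_wpM2l// lerXn2r ?nnegrE ?addr_ge0 ?L2norm_ge0//.
  by apply: ler_L2normD_Lfun; exact: F_Lfun.
Qed.

Lemma normFZ a v : normF (a *: v) = `|a| * normF v.
Proof.
rewrite /normF /F_deriv/= L2normZ (L2normZ_Lfun a (F_Lfun v)) F_funZ.
rewrite -[X in _ = X * _]sqrtr_sqr -sqrtrM ?sqr_ge0//; congr Num.sqrt.
by rewrite !exprMn real_normK ?num_real//; ring.
Qed.

Lemma normF_eq0 v : normF v = 0 -> v = 0.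
Proof.
move=> /eqP; rewrite sqrtr_eq0 => h.
have : L2norm mu (F_deriv v) = 0.
  by apply: sumsq3_le0 h => //; rewrite invr_gt0.
move=> /L2norm_eq0 dv0.
case/FgraphP: (valP v) => _ vI vT; apply: val_inj => /=.
have cv s t : s <= t -> (val v).1 t - (val v).1 s = 0.
  move=> st; rewrite vI// dv0.
  have := L2_RintegralZD (-1) (0 : L2 mu) 0 (measurable_itv `]s, t]).
  by rewrite scaler0 addr0 mulN1r addNr => ->.
rewrite [LHS]surjective_pairing dv0; congr pair; apply/funext => x.
have [/cv/eqP|/ltW/cv/eqP] := leP x T; rewrite vT.
- by rewrite sub0r oppr_eq0 => /eqP.
- by rewrite subr0 => /eqP.
Qed.

HB.instance Definition _ := Lmodule_isNormed.Build R F
  ler_normFD normFZ normF_eq0.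
End F.

Definition bform (R : realType) (lambda : {posnum R}) (T : R)
    (w : Espace lambda T) (v : Fspace lambda T) : R :=
  \int[muJ T]_x (E_fun w x * (- F_deriv v x + lambda%:num * F_fun v x)).

Definition dual_ball (R : realType) (V : normedModType R) : set {scalar V} :=
  [set phi | forall x, `|phi x| <= `|x|].
Arguments dual_ball {R} V.

Section tensor.
Variables (R : realType) (X Y : normedModType R) (Z : completeNormedModType R).
Variable t : {bilinear X -> Y -> Z}.

Definition tsum (s : seq (X * Y)) : Z := \sum_(p <- s) t p.1 p.2.

(* The finite sums of elementary tensors form an algebraic tensor product:
   every bilinear form on X * Y factors through them; Z is the completion. *)
Definition tensor_completion : Prop :=
  (forall s, tsum s = 0 -> forall beta : {bilinear X -> Y -> R | *%R & *%R},
     \sum_(p <- s) beta p.1 p.2 = 0) /\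
  dense (range tsum).

Definition is_projective_tensor : Prop :=
  tensor_completion /\
  forall s, `|tsum s| =
    inf [set \sum_(p <- s') `|p.1| * `|p.2| | s' in [set s' | tsum s' = tsum s]].

Definition is_injective_tensor : Prop :=
  tensor_completion /\
  forall s, `|tsum s| =
    sup [set `|\sum_(p <- s) (phi.1 : {scalar X}) p.1 * (phi.2 : {scalar Y}) p.2|
        | phi in dual_ball X `*` dual_ball Y].

Definition tensor_sub (A : set X) (B : set Y) : set Z :=
  [set z | exists2 s : seq (X * Y),
    forall p, p \in s -> A p.1 /\ B p.2 & z = tsum s].

End tensor.

Definition dual_norm (R : realType) (V : normedModType R) (ell : {scalar V}) : R :=
  sup [set `|ell x| | x in [set x | `|x| <= 1]].

Definition unit_sphere (R : realType) (V : normedModType R) (A : set V) : set V :=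
  [set x | A x /\ `|x| = 1].

Definition infsup (R : realType) (X Y : normedModType R) (b : X -> Y -> R)
    (A : set X) (B : set Y) : R :=
  inf [set sup [set b w v | v in unit_sphere B] | w in unit_sphere A].

(* Elements of L_2(J x J) are given by representatives, hence symmetry a.e. *)
Definition spsd_fun (R : realType) (T : R) (w : R -> R -> R) : Prop :=
  [/\ (fun p : measurableTypeR R * measurableTypeR R => w p.1 p.2)
        \in Lfun (muJ T \x muJ T)%E 2%:E,
      \forall p \ae (muJ T \x muJ T)%E, w p.1 p.2 = w p.2 p.1
    & forall phi : L2 (muJ T),
        0 <= \int[muJ T]_s (\int[muJ T]_x (w s x * L2_fun phi s * L2_fun phi x))].

Definition kernel_of (R : realType) (lambda : {posnum R}) (T : R)
    (s : seq (Espace lambda T * Espace lambda T)) (x y : R) : R :=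
  \sum_(p <- s) E_fun p.1 x * E_fun p.2 y.

(* w is a finite sum of w1 (x) w2, identified with the function
   (x, y) |-> sum of w1(x) w2(y) on J x J. *)
Definition spsd_tensor (R : realType) (lambda : {posnum R}) (T : R)
    (Epi : completeNormedModType R)
    (tE : {bilinear Espace lambda T -> Espace lambda T -> Epi}) (w : Epi) : Prop :=
  exists s, w = tsum tE s /\ spsd_fun T (kernel_of s).

Definition spsd_functional (R : realType) (F Feps : normedModType R)
    (tF : {bilinear F -> F -> Feps}) (ell : {scalar Feps}) : Prop :=
  (forall psi psi', ell (tF psi psi') = ell (tF psi' psi)) /\
  (forall psi, 0 <= ell (tF psi psi)).

Section discrete.
Variables (R : realType) (lambda : {posnum R}) (T : R).
Notation E := (Espace lambda T).
Notation F := (Fspace lambda T).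
Variables (N : nat) (t : nat -> R).

Definition is_mesh : Prop :=
  [/\ t 0%N = 0, t N = T & forall n, (1 <= n <= N)%N -> t n.-1 < t n].

Definition Fk : set F :=
  [set v | forall n, (1 <= n <= N)%N ->
    exists a c, forall x, t n.-1 <= x <= t n -> F_fun v x = a * x + c].

Definition is_hat_basis (v : nat -> F) : Prop :=
  forall i, (i < N)%N ->
    Fk (v i) /\ forall j, (j <= N)%N -> F_fun (v i) (t j) = (i == j)%:R.

Inductive scheme := CNstar | iEstar.

Definition profile (sch : scheme) (n : nat) (x : R) : R :=
  match sch with
  | CNstar => 1
  | iEstar => 4 - 6 * (x - t n.-1) / (t n - t n.-1)
  end.

Definition is_trial_basis (sch : scheme) (e : nat -> E) : Prop :=
  forall n, (1 <= n <= N)%N -> exists2 c : R, c != 0 &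
    \forall x \ae muJ T,
      E_fun (e n) x = c * profile sch n x * \1_(`]t n.-1, t n[%classic) x.

Definition Ek (e : nat -> E) : set E :=
  range (fun c : nat -> R => \sum_(1 <= n < N.+1) c n *: e n).

Definition uniform_mesh : Prop :=
  forall n, (1 <= n <= N)%N -> t n - t n.-1 = T / N%:R.

Definition uniform_scaling (e : nat -> E) : Prop :=
  (forall n, (1 <= n <= N)%N -> `|e n| = 1) /\
  (forall n, (1 <= n < N)%N -> \forall x \ae muJ T, t n.-1 < x < t n ->
     E_fun (e n.+1) (x + T / N%:R) = E_fun (e n) x).

End discrete.

Section coefficients.
(* b i n stands for b(e_n, v_i) and D n i j for
   Delta^k(e_n (x) e_n, v_i (x) v_j). *)
Variables (R : realType) (rho : R) (b : nat -> nat -> R) (D : nat -> nat -> nat -> R).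

Definition Delta11 n := D n n.-1 n.-1.
Definition Delta12 n := D n n.-1 n.
Definition Delta22 n := D n n n.

Definition beta_n n : R := (1 - rho ^+ 2 * b n.-1 n ^- 2 * Delta11 n)^-1.

Definition theta_n n : R := (b n.-1 n)^-1 * b n.-1 n.-1.

Definition alpha_n n : R :=
  beta_n n * (theta_n n ^+ 2 + rho ^+ 2 * b n.-1 n ^- 2 *
    (Delta22 n.-1 - 2 * (b n.-2 n.-1)^-1 * b n.-1 n.-1 * Delta12 n.-1)).

End coefficients.

Definition stability_constant (R : realType) (N : nat) (gamma alpha beta theta : R) : R :=
  if alpha == 1 then gamma ^- 2 * beta * (theta ^+ 2 + N%:R * (1 - theta ^+ 2))
  else gamma ^- 2 * beta *
       (1 + (alpha - theta ^+ 2) * ((alpha ^+ N.-1 - 1) / (alpha - 1))).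

(* Main.v *)
Require Import Defs.
From HB Require Import structures.
From mathcomp Require Import all_boot all_order all_algebra.
From mathcomp Require Import all_classical all_reals all_analysis.
From mathcomp Require Import measurable_realfun zify ring lra.
Set Implicit Arguments.
Unset Strict Implicit.
Unset Printing Implicit Defensive.
Import Order.TTheory GRing.Theory Num.Theory.
Import numFieldNormedType.Exports.
Local Open Scope classical_set_scope.
Local Open Scope ring_scope.

(** Write [e_n] for the trial basis, orthonormal because the [e_n] are unit
    vectors with disjoint supports, and let [psi_n] be the basis of the test
    space that is biorthogonal to it, [b e_m psi_n = (m == n)].  The inf-sup
    constant [gamma] controls the [psi_n]: a functional [phi] of norm at most
    one on the test space is represented by [w = \sum_n phi (psi_n) e_n], in
    the sense that [b w y = phi y] for every test function [y], hence
    [gamma * |w| <= 1], and orthonormality turns this into the Bessel type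
    inequality [\sum_n phi (psi_n) ^ 2 <= gamma ^ -2] ([dual_bessel]).  The
    injective norm is a supremum over pairs of such functionals, so
    [2 * |x * y| <= x ^ 2 + y ^ 2] gives [|\sum_n psi_n (x) psi_n| <= gamma ^ -2]
    ([dual_diagonal_norm]).

    Testing the equation for [U = \sum c_mn e_m (x) e_n] with
    [psi_m (x) psi_n] isolates [c_mn]: it equals
    [l (psi_m (x) psi_n) + rho ^ 2 \sum_k c_kk q_k (psi_m, psi_n)], where
    [q_k] is the form induced by [Delta] at [e_k (x) e_k]; only the diagonal
    of [c] feeds back, because [Delta] ignores [e_m (x) e_n] for [m != n].
    Since [b] couples [e_n] to the two neighbouring hat functions only, [psi_n]
    is computed by the two-term recursion of forward substitution, and the
    locality of [Delta] then collapses the dependence of [c_nn] on all the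
    past [c_kk] into the scalar recursion
    [c_(n+1)(n+1) = alpha c_nn + beta (l_(n+1) - theta ^ 2 l_n)] with
    [l_n = l (psi_n (x) psi_n)] ([memory_collapse], [diag_recursion]).
    Moreover [alpha - theta ^ 2 = beta rho ^ 2 q_n (psi_(n+1), psi_(n+1))] is
    nonnegative.  Solving the recursion shows that the [c_nn] are nonnegative
    and that their sum is at most
    [beta (1 + (alpha - theta ^ 2) \sum_(i < N - 1) alpha ^ i) \sum_n l_n]
    ([recursion_bound]); the last sum is the value of [l] at
    [\sum_n psi_n (x) psi_n], whose norm has been bounded above.

    Finally, nonnegativity of the diagonal makes the whole matrix [c] positive
    semidefinite by the formula for [c_mn].  Factoring [c] as a Gram matrix
    writes [U] as a sum of squares [u_i (x) u_i], so that the projective norm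
    of [U] is at most the trace [\sum_n c_nn] ([projective_norm_le_trace]).

    Two facts about the function spaces are needed to apply this argument to
    the discretization.  A test function that vanishes on a mesh interval is
    annihilated by the trial function living there, which requires its weak
    derivative to vanish almost everywhere on that interval ([F_deriv_ae0]);
    and [e_n (x) e_n] is positive semidefinite as a kernel, so that the
    assumption on [Delta] does apply to the forms [q_n]. *)

(** * The scalar recursion *)

Section recursion.
Variable R : realFieldType.
Implicit Types (alpha beta theta : R) (a l : nat -> R) (Q : nat -> nat -> R).

(** The kernel [Q] describes how [a n] depends on the earlier [a m].  Because the
    row [n.+1] of [Q] is [theta ^+ 2] times the row [n] away from the last two
    entries, the whole past enters [a n.+1] only through
    [\sum_(m < n) a m * Q n m], which the equation for [a n] expresses by
    [a n] and [l n]. *)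
Lemma memory_collapse M alpha beta theta a l Q : beta != 0 ->
  (forall n m, (n < m < M.+1)%N -> Q n m = 0) ->
  (forall n, (n < M.+1)%N -> Q n n = 1 - beta^-1) ->
  (forall n m, (m < n < M)%N -> Q n.+1 m = theta ^+ 2 * Q n m) ->
  (forall n, (n < M)%N -> Q n.+1 n = beta^-1 * (alpha - theta ^+ 2)) ->
  (forall n, (n < M.+1)%N -> a n = l n + \sum_(m < M.+1) a m * Q n m) ->
  a 0%N = beta * l 0%N /\
  forall n, (n < M)%N -> a n.+1 = alpha * a n + beta * (l n.+1 - theta ^+ 2 * l n).
Proof.
move=> b0 Q0 Qd Qm Qs aE.
have trunc n : (n < M.+1)%N ->
    beta^-1 * a n = l n + \sum_(m < n) a m * Q n m.
  move=> nM; have := aE n nM.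
  rewrite -(big_mkord xpredT (fun m => a m * Q n m)) (big_cat_nat (n := n.+1))//=.
  rewrite [X in _ + (_ + X)]big_nat [X in _ + (_ + X)]big1 ?addr0; last first.
    by move=> m mM; rewrite Q0 ?mulr0.
  rewrite big_nat_recr//= Qd// big_mkord.
  by set S := \sum_(m < n) _; rewrite mulrBr mulr1 mulrC => {}aE; lra.
split; first by rewrite -[LHS](mulKf (invr_neq0 b0)) invrK trunc// big_ord0 addr0.
move=> n nM; have nM' : (n < M.+1)%N by exact: ltnW.
have := trunc n.+1 nM.
rewrite big_ord_recr/= Qs//.
have -> : \sum_(m < n) a m * Q n.+1 m = theta ^+ 2 * (beta^-1 * a n - l n).
  rewrite (trunc n)// addrC addKr mulr_sumr; apply: eq_bigr => m _.
  by rewrite Qm ?ltn_ord// mulrCA.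
move=> /(congr1 (fun x => beta * x)); rewrite mulrA divff// mul1r => ->.
by field.
Qed.

(** The recursion has the closed form [a n = beta * l n + beta * (alpha -
    theta ^+ 2) * g n], where [g n] is the discrete convolution of [l] with the
    powers of [alpha].  When [M = 0] there is no step of the recursion, and
    [alpha] and [theta] are then arbitrary. *)
Lemma recursion_bound M alpha beta theta a l : 0 < beta ->
  ((0 < M)%N -> theta ^+ 2 <= alpha) ->
  (forall n, 0 <= l n) ->
  a 0%N = beta * l 0%N ->
  (forall n, (n < M)%N -> a n.+1 = alpha * a n + beta * (l n.+1 - theta ^+ 2 * l n)) ->
  (forall n, (n < M.+1)%N -> 0 <= a n) /\
  \sum_(n < M.+1) a n <=
    beta * (1 + (alpha - theta ^+ 2) * \sum_(i < M) alpha ^+ i) * \sum_(n < M.+1) l n.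
Proof.
move=> b0 at2 l0 a0 aS.
case: M at2 aS => [_ _|M /(_ isT) at2 aS].
  rewrite !big_ord_recl !big_ord0 mulr0 !addr0 mulr1 a0; split => // -[_|//].
  by rewrite a0 mulr_ge0// ltW.
have al0 : 0 <= alpha := le_trans (sqr_ge0 _) at2.
pose g := fix g n := if n is k.+1 then alpha * g k + l k else 0.
have g0 n : 0 <= g n by elim: n => //= n gn; rewrite addr_ge0// mulr_ge0.
have aE n : (n < M.+2)%N -> a n = beta * l n + beta * (alpha - theta ^+ 2) * g n.
  elim: n => [|n IH] nM /=; first by rewrite mulr0 addr0.
  by rewrite aS// IH ?(ltn_trans _ nM)//; ring.
split=> [n nM|].
  by rewrite aE// addr_ge0// ?mulr_ge0 ?subr_ge0// ltW.
have gE n : \sum_(i < n.+1) g i <= (\sum_(i < n) alpha ^+ i) * \sum_(i < n.+1) l i.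
  elim: n => [|n IH]; first by rewrite big_ord_recl !big_ord0 addr0 mul0r.
  rewrite big_ord_recl/= add0r.
  rewrite big_split -mulr_sumr/= [X in _ <= X * _]big_ord_recl expr0.
  rewrite (_ : \sum_(i < n) alpha ^+ _ = alpha * \sum_(i < n) alpha ^+ i); last first.
    by rewrite mulr_sumr; apply: eq_bigr => i _; rewrite -exprS.
  set s := \sum_(i < n) _ in IH *.
  have s0 : 0 <= s by apply: sumr_ge0 => i _; rewrite exprn_ge0.
  rewrite (big_ord_recr n.+1)/= mulrDl mul1r mulrDr addrC.
  set L := \sum_(i < _) l i in IH *.
  have IH' := ler_wpM2l al0 IH.
  have : 0 <= (1 + alpha * s) * l n.+1 by rewrite mulr_ge0// addr_ge0// mulr_ge0.
  by move: IH'; rewrite mulrA mulrDl mul1r; lra.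
rewrite (eq_bigr (fun i : 'I__ => beta * l i + beta * (alpha - theta ^+ 2) * g i)); last first.
  by move=> i _; rewrite aE.
rewrite big_split/= -!mulr_sumr.
set D := alpha - _; set S := \sum_(i < M.+1) _; set L := \sum_(i < M.+2) l i.
have -> : beta * (1 + D * S) * L = beta * L + beta * D * (S * L) by ring.
by rewrite lerD2l ler_wpM2l ?gE// mulr_ge0 ?subr_ge0// ltW.
Qed.

End recursion.

(** * Positive semidefinite matrices as Gram matrices *)

Section psd.
Variable R : realFieldType.

(** Completing the square in the first variable, as in one step of Cholesky's
    algorithm, starts from this expansion. *)
Lemma quadratic_split n (A : nat -> nat -> R) (x : nat -> R) :
  (forall j k, A j k = A k j) ->
  \sum_(j < n.+1) \sum_(k < n.+1) x j * x k * A j k =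
  x 0%N ^+ 2 * A 0%N 0%N + 2 * x 0%N * (\sum_(k < n) x k.+1 * A 0%N k.+1) +
  \sum_(j < n) \sum_(k < n) x j.+1 * x k.+1 * A j.+1 k.+1.
Proof.
move=> Asym; rewrite big_ord_recl big_ord_recl/=.
under [X in _ + X = _]eq_bigr do rewrite big_ord_recl/=.
rewrite big_split/= expr2 !addrA; congr (_ + _); rewrite -!addrA; congr (_ + _).
rewrite mulr_sumr -big_split/=; apply: eq_bigr => k _.
by rewrite /bump /= add1n (Asym k.+1 0%N); ring.
Qed.

End psd.

(** Cholesky factorization: either the first pivot is positive and the Schur
    complement is again positive semidefinite, or it is zero and the first row
    vanishes.  Both cases use the same formulas, since [0^-1 = 0]. *)
Lemma psd_factor (R : rcfType) N (A : nat -> nat -> R) :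
  (forall j k, A j k = A k j) ->
  (forall x : nat -> R, 0 <= \sum_(j < N) \sum_(k < N) x j * x k * A j k) ->
  exists L : nat -> nat -> R, forall j k, (j < N)%N -> (k < N)%N ->
    A j k = \sum_(i < N) L i j * L i k.
Proof.
elim: N A => [|n IH] A Asym A0; first by exists (fun _ _ => 0).
pose x0 t (y : nat -> R) (j : nat) := if j is k.+1 then y k else t.
have {}A0 t (y : nat -> R) : 0 <= t ^+ 2 * A 0%N 0%N + 2 * t * (\sum_(k < n) y k * A 0%N k.+1) +
    \sum_(j < n) \sum_(k < n) y j * y k * A j.+1 k.+1.
  by have := A0 (x0 t y); rewrite quadratic_split.
have a0 : 0 <= A 0%N 0%N.
  have := A0 1 (fun=> 0).
  rewrite !big1 ?mulr0 ?addr0 ?expr1n ?mul1r// => j _.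
    by rewrite big1// => k _; rewrite !mul0r.
  by rewrite mul0r.
have r0 k : (k < n)%N -> A 0%N 0%N = 0 -> A 0%N k.+1 = 0.
  move=> kn A00; apply/eqP/negP => /negP rk.
  pose y (j : nat) : R := (j == k)%:R.
  have S1 (f : nat -> R) : \sum_(j < n) y j * f j = f k.
    rewrite (bigD1 (Ordinal kn))//= /y eqxx mul1r big1 ?addr0// => j /negbTE.
    by rewrite -val_eqE/= => ->; rewrite mul0r.
  have S2 : \sum_(j < n) \sum_(i < n) y j * y i * A j.+1 i.+1 = A k.+1 k.+1.
    rewrite -(S1 (fun j => A j.+1 k.+1)); apply: eq_bigr => j _.
    rewrite -(S1 (fun i => A j.+1 i.+1)) mulr_sumr; apply: eq_bigr => i _.
    by rewrite mulrA.
  (* At this point the quadratic form would take the value -1. *)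
  have := A0 (- (A k.+1 k.+1 + 1) / (2 * A 0%N k.+1)) y.
  rewrite (S1 (fun j => A 0%N j.+1)) S2 A00 mulr0 add0r.
  rewrite (_ : _ * _ * _ + _ = -1); first by rewrite lerNr oppr0 ler10.
  by field.
pose B j k := A j.+1 k.+1 - A 0%N j.+1 * A 0%N k.+1 / A 0%N 0%N.
have [||L LE] := IH B; first by move=> j k; rewrite /B Asym (mulrC (A 0%N j.+1)).
  move=> y; set c := \sum_(k < n) y k * A 0%N k.+1.
  have -> : \sum_(j < n) \sum_(k < n) y j * y k * B j k =
      \sum_(j < n) \sum_(k < n) y j * y k * A j.+1 k.+1 - c ^+ 2 / A 0%N 0%N.
    rewrite expr2 {1}/c mulr_suml mulr_suml -sumrB; apply: eq_bigr => j _.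
    rewrite /c mulr_sumr mulr_suml -sumrB; apply: eq_bigr => k _.
    by rewrite /B; ring.
  have [A00|A00] := eqVneq (A 0%N 0%N) 0.
    by rewrite A00 invr0 mulr0 subr0; have := A0 0 y; rewrite expr0n/= !mulr0 !mul0r !add0r.
  (* The first coordinate that minimizes the quadratic form. *)
  have := A0 (- c / A 0%N 0%N) y; rewrite -/c; congr (_ <= _).
  by field.
exists (fun i j => if i is i'.+1 then (if j is j'.+1 then L i' j' else 0)
                   else A 0%N j / Num.sqrt (A 0%N 0%N)).
have sq : Num.sqrt (A 0%N 0%N) ^+ 2 = A 0%N 0%N by rewrite sqr_sqrtr.
move=> j k jn kn; rewrite big_ord_recl/= (_ : _ * _ = A 0%N j * A 0%N k / A 0%N 0%N); last first.
  by rewrite -[in RHS]sq expr2 invfM; ring.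
case: j k jn kn => [|j] [|k] jn kn.
- rewrite big1 ?addr0; last by move=> i _; rewrite mulr0.
  by have [->|?] := eqVneq (A 0%N 0%N) 0; rewrite ?mulr0 ?mul0r// mulfK.
- rewrite big1 ?addr0; last by move=> i _; rewrite mul0r.
  by have [A00|?] := eqVneq (A 0%N 0%N) 0; [rewrite A00 !mul0r r0|rewrite mulrAC divff ?mul1r].
- rewrite big1 ?addr0; last by move=> i _; rewrite mulr0.
  rewrite Asym; have [A00|?] := eqVneq (A 0%N 0%N) 0; last by rewrite mulfK.
  by rewrite A00 mulr0 mul0r r0.
- by rewrite (eq_bigr (fun i : 'I_n => L i j * L i k))// -LE// /B addrC subrK.
Qed.

(** * Tensor norms, dual norms and the inf-sup constant *)

Section tensor_norms.
Variables (R : realType) (X Y : normedModType R) (Z : completeNormedModType R).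
Variable t : {bilinear X -> Y -> Z}.

Lemma projective_norm_le s : is_projective_tensor t ->
  `|tsum t s| <= \sum_(p <- s) `|p.1| * `|p.2|.
Proof.
move=> [_ ->]; apply: ge_inf; last by exists s.
exists 0 => _ [s' _ <-]; apply: sumr_ge0 => p _; exact: mulr_ge0.
Qed.

Lemma injective_norm_le s C : is_injective_tensor t ->
  (forall (phi1 : {scalar X}) (phi2 : {scalar Y}), dual_ball X phi1 -> dual_ball Y phi2 ->
     `|\sum_(p <- s) phi1 p.1 * phi2 p.2| <= C) ->
  `|tsum t s| <= C.
Proof.
move=> [_ ->] h; apply: ge_sup.
  exists `|\sum_(p <- s) (\0 : {scalar X}) p.1 * (\0 : {scalar Y}) p.2|.
  by exists (\0 : {scalar X}, \0 : {scalar Y}) => //; split=> x /=; rewrite normr0.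
by move=> _ [[p1 p2] [/= h1 h2] <-]; exact: h.
Qed.

End tensor_norms.

(** Continuity bounds the set whose supremum is the dual norm; over an
    unbounded set that supremum would be [0]. *)
Lemma dual_norm_bound (R : realType) (V : normedModType R) (ell : {scalar V}) x :
  continuous (ell : V -> R) -> `|ell x| <= dual_norm ell * `|x|.
Proof.
move=> cell.
have /linear_boundedP [r [_ /(_ (Num.max r 0 + 1))]] := continuous_linear_bounded 0 (cell 0).
rewrite (le_lt_trans _ (ltr_pwDr _ (lexx _)))// ?le_max ?lexx// => /(_ isT) rE.
have [->|x0] := eqVneq x 0; first by rewrite linear0 !normr0 mulr0.
have nx : 0 < `|x| by rewrite normr_gt0.
rewrite -ler_pdivrMr//; apply: ub_le_sup; last first.
  exists (`|x|^-1 *: x); last by rewrite linearZ normrM gtr0_norm ?invr_gt0// mulrC.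
  by rewrite /= normrZ gtr0_norm ?invr_gt0// mulVf// gt_eqF.
exists (Num.max r 0 + 1) => _ [y /= y1 <-]; apply: (le_trans (rE y)).
by rewrite ler_piMr// addr_ge0// le_max lexx orbT.
Qed.

Lemma dual_norm_ge0 (R : realType) (V : normedModType R) (ell : {scalar V}) :
  0 <= dual_norm ell.
Proof.
have [[_ ub]|] := pselect (has_sup [set `|ell x| | x in [set x | `|x| <= 1]]).
  apply: (@le_trans _ _ `|ell 0|) => //; apply: ub_le_sup => //.
  by exists 0 => //=; rewrite normr0.
by rewrite /dual_norm => /sup_out ->.
Qed.

(** Positivity of [infsup b A B] is what makes its defining infimum meaningful:
    an infimum over an empty or unbounded set would be [0]. *)
Lemma infsup_mul_le (R : realType) (X Y : normedModType R)
    (b : {bilinear X -> Y -> R | *%R & *%R}) (A : set X) (B : set Y) w C :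
  0 < infsup b A B -> (forall a x, A x -> A (a *: x)) -> A w -> 0 <= C ->
  (forall y, B y -> b w y <= C * `|y|) ->
  infsup b A B * `|w| <= C.
Proof.
move=> g0 AZ Aw C0 bC.
have [->|w0] := eqVneq w 0; first by rewrite normr0 mulr0.
have nw : 0 < `|w| by rewrite normr_gt0.
rewrite -ler_pdivlMr//; rewrite /infsup in g0 *; set S := (X in inf X) in g0 *.
have [_ lbS] : has_inf S.
  by apply/not_notP => /inf_out S0; move: g0; rewrite S0 ltxx.
apply: (@le_trans _ _ (sup [set b (`|w|^-1 *: w) y | y in unit_sphere B])).
  apply: ge_inf => //; exists (`|w|^-1 *: w) => //; split; first exact: AZ.
  by rewrite normrZ gtr0_norm ?invr_gt0// mulVf// gt_eqF.
have [->|/set0P S0] := eqVneq [set b (`|w|^-1 *: w) y | y in unit_sphere B] set0.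
  by rewrite sup0 divr_ge0.
apply: ge_sup => // _ [y [By y1] <-].
by rewrite linearZl_LR mulrC ler_pM2r ?invr_gt0// (le_trans (bC _ By))// y1 mulr1.
Qed.

(** * The biorthogonal test basis *)

Section dual_basis.
Variables (R : fieldType) (Y : lmodType R) (d o : nat -> R) (v : nat -> Y).

(** Forward substitution for a bidiagonal matrix with diagonal [d] and
    off-diagonal [o]. *)
Fixpoint dual_basis n : Y :=
  if n is k.+1 then (d n)^-1 *: (v n - o k *: dual_basis k) else (d 0%N)^-1 *: v 0%N.

(** Up to the span of the earlier [v j], [dual_basis n] is [(d n)^-1 *: v n]. *)
Lemma dual_basis_leading (f : {scalar Y}) n :
  (forall j, (j < n)%N -> f (v j) = 0) ->
  f (dual_basis n) = (d n)^-1 * f (v n).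
Proof.
elim: n => [|n IH] f0 /=; first by rewrite linearZ.
rewrite linearZ linearB linearZ /= IH => [|j jn]; last by rewrite f0// ltnW.
by rewrite (f0 n)// !mulr0 subr0.
Qed.

Lemma dual_basis_comb (P : Y -> Prop) n :
  (forall a y z, P y -> P z -> P (a *: y + z)) -> P 0 ->
  (forall j, (j <= n)%N -> P (v j)) -> P (dual_basis n).
Proof.
move=> PD P0; elim: n => [|n IH] Pv /=; first by rewrite -[X in P X]addr0; apply: PD => //; exact: Pv.
rewrite -[X in P X]addr0; apply: (PD) => //; rewrite addrC -scaleNr.
by apply: PD; [apply: IH => j jn; apply: Pv; exact: ltnW (leq_ltn_trans jn _)|exact: Pv].
Qed.

End dual_basis.

Arguments dual_basis_leading {R Y d o v} f n.

Section dual_system.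
Variables (R : realType) (X Y : normedModType R).
Variable b : {bilinear X -> Y -> R | *%R & *%R}.
Variables (M : nat) (e : nat -> X) (v : nat -> Y) (A : set X) (B : set Y).
Local Notation N := M.+1.
Hypothesis e_orthonormal : forall c : nat -> R,
  `|\sum_(i < N) c i *: e i| ^+ 2 = \sum_(i < N) c i ^+ 2.
Hypothesis A_span : A = range (fun c : nat -> R => \sum_(i < N) c i *: e i).
Hypothesis B_span : B = range (fun c : nat -> R => \sum_(i < N) c i *: v i).
Hypothesis b_local : forall m i, (m < N)%N -> (i < N)%N -> i != m -> i != m.+1 ->
  b (e m) (v i) = 0.
Hypothesis gamma_gt0 : 0 < infsup b A B.

Local Notation d := (fun k => b (e k) (v k)).
Local Notation o := (fun k => b (e k) (v k.+1)).
Local Notation psi := (dual_basis d o v).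

Lemma trial_scale a x : A x -> A (a *: x).
Proof.
rewrite A_span => -[c _ <-]; exists (fun i => a * c i) => //.
by rewrite scaler_sumr; apply: eq_bigr => i _; rewrite scalerA.
Qed.

Lemma test_comb a y z : B y -> B z -> B (a *: y + z).
Proof.
rewrite B_span => -[c _ <-] [c' _ <-]; exists (fun i => a * c i + c' i) => //.
by rewrite scaler_sumr -big_split; apply: eq_bigr => i _; rewrite scalerA scalerDl.
Qed.

Lemma test_0 : B 0.
Proof.
by rewrite B_span; exists (fun=> 0) => //; rewrite big1// => i _; rewrite scale0r.
Qed.

Lemma test_basis i : (i < N)%N -> B (v i).
Proof.
move=> iN; rewrite B_span; exists (fun j => (j == i)%:R) => //.
rewrite (bigD1 (Ordinal iN))//= eqxx scale1r big1 ?addr0// => j.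
by rewrite -val_eqE/= => /negbTE ->; rewrite scale0r.
Qed.

Lemma dual_basis_test n : (n < N)%N -> B (psi n).
Proof.
move=> nN; apply: dual_basis_comb; [exact: test_comb|exact: test_0|] => j jn.
by apply: test_basis; exact: leq_ltn_trans jn nN.
Qed.

(** The matrix [b (e j) (v i)] is triangular, so its determinant is the
    product of the entries in question.  A nonzero vector in its kernel would
    give a nonzero trial function that is orthogonal to every test function,
    against the inf-sup condition. *)
Lemma trial_test_diag_neq0 m : (m < N)%N -> b (e m) (v m) != 0.
Proof.
move=> mN; pose G : 'M[R]_N := \matrix_(i, j) b (e j) (v i).
have : \det G != 0.
  rewrite -det_tr; apply/negP => /det0P[c c0 cG]; case/negP: c0.
  pose c' i := c 0 (inord i).
  pose w := \sum_(i < N) c' i *: e i.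
  have cE (i : 'I_N) : c' i = c 0 i by rewrite /c' inord_val.
  have bw y : B y -> b w y = 0.
    rewrite B_span => -[a _ <-]; rewrite linear_sumr big1// => j _.
    rewrite linearZr_LR /= linear_sumlz.
    move/matrixP: cG => /(_ 0 j); rewrite !mxE => cG.
    rewrite (eq_bigr (fun i => c 0 i * G^T i j)) ?cG ?mulr0// => i _.
    by rewrite linearZl_LR !mxE cE.
  have : infsup b A B * `|w| <= 0.
    apply: infsup_mul_le => //; first exact: trial_scale.
      by rewrite A_span; exists c'.
    by move=> y By; rewrite bw// mul0r.
  rewrite pmulr_rle0// normr_le0 => /eqP w0.
  have := e_orthonormal c'; rewrite -/w w0 normr0 expr0n/= => /esym/eqP.
  rewrite psumr_eq0; last by move=> i _; exact: sqr_ge0.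
  move=> /allP c0; apply/eqP/rowP => i; rewrite mxE -cE.
  by apply/eqP; rewrite -sqrf_eq0; apply: c0; rewrite mem_index_enum.
rewrite det_trig => [|].
  by move/prodf_neq0 => /(_ (Ordinal mN) isT); rewrite !mxE.
apply/is_trig_mxP => i j ij; rewrite !mxE.
by rewrite b_local// ltn_eqF// ltnS ltnW.
Qed.

Lemma dual_biorthogonal m n : (m < N)%N -> (n < N)%N -> b (e m) (psi n) = (m == n)%:R.
Proof.
move=> mN; elim: n => [|n IH] nN.
  rewrite (dual_basis_leading (b (e m)))//=.
  have [->|m0] := eqVneq m 0%N; first by rewrite mulVf// trial_test_diag_neq0.
  by rewrite (b_local mN) ?mulr0// eq_sym.
have nN' : (n < N)%N by exact: ltnW.
rewrite /= linearZr_LR linearBr linearZr_LR/= IH//.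
have [->|mn] := eqVneq m n.
  by rewrite mulr1 subrr mulr0 ltn_eqF.
rewrite mulr0 subr0; have [->|mn1] := eqVneq m n.+1; first by rewrite mulVf// trial_test_diag_neq0.
by rewrite (b_local mN) ?mulr0// eq_sym.
Qed.

Lemma test_basis_dual i : (i < N)%N ->
  v i = d i *: psi i + (if i is k.+1 then o k *: psi k else 0).
Proof.
case: i => [|i] iN /=; rewrite scalerA divff ?trial_test_diag_neq0// scale1r ?addr0//.
by rewrite subrK.
Qed.

(** Riesz representation of functionals on the test space by trial functions;
    this is where the two spaces having the same dimension matters. *)
Lemma trial_representative (phi : {scalar Y}) y : B y ->
  b (\sum_(n < N) phi (psi n) *: e n) y = phi y.
Proof.
set w := \sum_(n < N) _.
have wpsi n : (n < N)%N -> b w (psi n) = phi (psi n).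
  move=> nN; rewrite linear_sumlz (bigD1 (Ordinal nN))//= big1 ?addr0.
    by rewrite linearZl_LR/= dual_biorthogonal// eqxx mulr1.
  move=> m; rewrite -val_eqE/= => /negbTE mn.
  by rewrite linearZl_LR/= dual_biorthogonal// mn mulr0.
rewrite B_span => -[c _ <-]; rewrite linear_sumr linear_sum; apply: eq_bigr => i _.
rewrite linearZr_LR linearZ/=; congr (_ * _).
rewrite test_basis_dual// linearDr linearD linearZr_LR linearZ/= wpsi//; congr (_ + _).
case: (nat_of_ord i) (ltn_ord i) => [|k] kN; first by rewrite linear0r linear0.
by rewrite linearZr_LR linearZ/= wpsi// ltnW.
Qed.

(** The coefficients [phi (psi n)] are those of the representative of [phi], whose
    norm the inf-sup constant bounds by [(infsup b A B)^-1]. *)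
Lemma dual_bessel (phi : {scalar Y}) : dual_ball Y phi ->
  \sum_(n < N) phi (psi n) ^+ 2 <= infsup b A B ^- 2.
Proof.
move=> phi1; have := e_orthonormal (fun n => phi (psi n)).
set w := \sum_(n < N) _ *: _ => <-.
have Aw : A w by rewrite A_span; exists (fun n => phi (psi n)).
have : infsup b A B * `|w| <= 1.
  apply: infsup_mul_le => //; first exact: trial_scale.
  by move=> y By; rewrite trial_representative// mul1r (le_trans (ler_norm _))// phi1.
rewrite mulrC -ler_pdivlMr// mul1r => h.
by rewrite -exprVn lerXn2r// nnegrE// invr_ge0 ltW.
Qed.

Lemma dual_diagonal_norm (W : completeNormedModType R) (tY : {bilinear Y -> Y -> W}) :
  is_injective_tensor tY ->
  `|\sum_(n < N) tY (psi n) (psi n)| <= infsup b A B ^- 2.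
Proof.
move=> injY; have -> : \sum_(n < N) tY (psi n) (psi n) =
    tsum tY [seq (psi n, psi n) | n : 'I_N].
  by rewrite /tsum big_image.
apply: injective_norm_le => // phi1 phi2 ball1 ball2.
rewrite big_image/=; apply: (le_trans (ler_norm_sum _ _ _)).
have h1 := dual_bessel ball1; have h2 := dual_bessel ball2.
apply: (@le_trans _ _ (2^-1 * (\sum_(n < N) phi1 (psi n) ^+ 2 + \sum_(n < N) phi2 (psi n) ^+ 2))).
  rewrite -big_split mulr_sumr; apply: ler_sum => n _ /=.
  rewrite normrM -[phi1 _ ^+ 2]real_normK ?num_real// -[phi2 _ ^+ 2]real_normK ?num_real//.
  have := sqr_ge0 (`|phi1 (psi n)| - `|phi2 (psi n)|); lra.
lra.
Qed.

End dual_system.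

(** * Bilinear forms on the biorthogonal basis *)

Definition tensor_form (R : realType) (Y W : lmodType R) (t : {bilinear Y -> Y -> W})
  (f : {scalar W}) (y z : Y) : R := f (t y z).

Section tensor_form.
Variables (R : realType) (Y W : lmodType R) (t : {bilinear Y -> Y -> W}) (f : {scalar W}).
Lemma tensor_form_bilinear : bilinear_for
  (GRing.Scale.Law.clone R R *%R _) (GRing.Scale.Law.clone R R *%R _) (tensor_form t f).
Proof. by split=> z a x y; rewrite /tensor_form ?linearPl ?linearPr linearP. Qed.
HB.instance Definition _ := bilinear_isBilinear.Build R Y Y R
  (GRing.Scale.Law.clone R R *%R _) (GRing.Scale.Law.clone R R *%R _)
  (tensor_form t f) tensor_form_bilinear.
End tensor_form.

Section dual_basis_form.
Variables (R : realType) (Y : lmodType R) (d o : nat -> R) (v : nat -> Y).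
Local Notation psi := (dual_basis d o v).
Implicit Types g : {bilinear Y -> Y -> R | *%R & *%R}.

Lemma dual_basis_form_leading g m n :
  (forall i j, (i <= m)%N -> (j <= n)%N -> (i < m)%N || (j < n)%N -> g (v i) (v j) = 0) ->
  g (psi m) (psi n) = (d m)^-1 * (d n)^-1 * g (v m) (v n).
Proof.
move=> g0.
have gm j : (j <= n)%N -> g (psi m) (v j) = (d m)^-1 * g (v m) (v j).
  move=> jn; rewrite -!(applyrE g (v j)).
  rewrite (dual_basis_leading (applyr g (v j) : {scalar Y}))// => i im.
  by rewrite /= g0 ?im// ltnW.
rewrite (dual_basis_leading (g (psi m))) => [|j jn] /=.
  by rewrite gm// mulrCA mulrA.
by rewrite gm ?(ltnW jn)// g0 ?jn ?orbT ?mulr0// ltnW.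
Qed.

(** One step of the substitution that defines the dual basis; the cross terms
    see only the last [v n] in [dual_basis n]. *)
Lemma dual_basis_form_step g n :
  (forall j, (j < n)%N -> g (v n.+1) (v j) = 0 /\ g (v j) (v n.+1) = 0) ->
  g (psi n.+1) (psi n.+1) = (o n / d n.+1) ^+ 2 * g (psi n) (psi n) +
    (d n.+1) ^- 2 * (g (v n.+1) (v n.+1) -
      (d n)^-1 * o n * (g (v n) (v n.+1) + g (v n.+1) (v n))).
Proof.
move=> g0 /=.
rewrite linearZl_LR linearZr_LR/= linearBl !linearBr !linearZl_LR !linearZr_LR/=.
have -> : g (v n.+1) (psi n) = (d n)^-1 * g (v n.+1) (v n).
  by apply: (dual_basis_leading (g (v n.+1))) => j /g0[].
have -> : g (psi n) (v n.+1) = (d n)^-1 * g (v n) (v n.+1).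
  rewrite -!(applyrE g (v n.+1)).
  by apply: (dual_basis_leading (applyr g (v n.+1) : {scalar Y})) => j /g0[].
by rewrite -exprVn /GRing.scale /=; ring.
Qed.

End dual_basis_form.

(** * Stability of the abstract discrete problem *)

(** An element of the algebraic tensor product of finite-dimensional spaces has
    a coefficient matrix in the product basis. *)
Lemma tensor_sub_coef (R : realType) (X : normedModType R) (Z : completeNormedModType R)
    (t : {bilinear X -> X -> Z}) (e : nat -> X) N (A : set X) U :
  A = range (fun c : nat -> R => \sum_(i < N) c i *: e i) ->
  tensor_sub t A A U ->
  exists c : nat -> nat -> R, U = \sum_(m < N) \sum_(n < N) c m n *: t (e m) (e n).
Proof.
move=> -> [s + ->]; elim: s => [|p s IH] sA.
  exists (fun _ _ => 0); rewrite /tsum big_nil big1// => m _.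
  by rewrite big1// => n _; rewrite scale0r.
have [q qs|c cE] := IH; first by apply: sA; rewrite inE qs orbT.
have [|[a _ aE] [a' _ a'E]] := sA p; first by rewrite inE eqxx.
exists (fun m n => a m * a' n + c m n).
rewrite /tsum big_cons -/(tsum t s) cE -aE -a'E.
rewrite linear_sumlz -big_split; apply: eq_bigr => m _ /=.
rewrite linear_sumr -big_split; apply: eq_bigr => n _ /=.
by rewrite linearZl_LR linearZr_LR /= scalerA scalerDl.
Qed.

Section stability.
Variables (R : realType) (X Y : normedModType R) (Z W : completeNormedModType R).
Variables (tX : {bilinear X -> X -> Z}) (tY : {bilinear Y -> Y -> W}).
Hypothesis tX_projective : is_projective_tensor tX.
Hypothesis tY_injective : is_injective_tensor tY.
Variable b : {bilinear X -> Y -> R | *%R & *%R}.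
Variable B : {bilinear Z -> W -> R | *%R & *%R}.
Hypothesis B_elementary : forall w1 w2 y1 y2,
  B (tX w1 w2) (tY y1 y2) = b w1 y1 * b w2 y2.
Variables (M : nat) (e : nat -> X) (v : nat -> Y) (A : set X) (F : set Y).
Local Notation N := M.+1.
Hypothesis e_orthonormal : forall c : nat -> R,
  `|\sum_(i < N) c i *: e i| ^+ 2 = \sum_(i < N) c i ^+ 2.
Hypothesis A_span : A = range (fun c : nat -> R => \sum_(i < N) c i *: e i).
Hypothesis F_span : F = range (fun c : nat -> R => \sum_(i < N) c i *: v i).
Hypothesis b_local : forall m i, (m < N)%N -> (i < N)%N -> i != m -> i != m.+1 ->
  b (e m) (v i) = 0.
Hypothesis gamma_gt0 : 0 < infsup b A F.
Variable Delta : {bilinear Z -> W -> R | *%R & *%R}.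

Let d k := b (e k) (v k).
Let o k := b (e k) (v k.+1).
Let psi := dual_basis d o v.
Let q m : {bilinear Y -> Y -> R | *%R & *%R} :=
  tensor_form tY (Delta (tX (e m) (e m))).

Hypothesis q_sym : forall m y z, (m < N)%N -> F y -> F z -> q m y z = q m z y.
Hypothesis q_ge0 : forall m y, (m < N)%N -> F y -> 0 <= q m y y.
Hypothesis q_local : forall m i j, (m < N)%N -> (i < N)%N -> (j < N)%N ->
  q m (v i) (v j) != 0 -> (m <= i <= m.+1)%N && (m <= j <= m.+1)%N.
Hypothesis Delta_diagonal : forall m n i j, (m < N)%N -> (n < N)%N ->
  (i < N)%N -> (j < N)%N -> m != n -> Delta (tX (e m) (e n)) (tY (v i) (v j)) = 0.

Variables (rho alpha beta theta : R).
Hypothesis beta_gt0 : 0 < beta.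
Hypothesis betaE : forall n, (n < N)%N ->
  beta^-1 = 1 - rho ^+ 2 * d n ^- 2 * q n (v n) (v n).
Hypothesis thetaE : forall n, (n < M)%N -> theta = o n / d n.+1.
Hypothesis alphaE : forall n, (n < M)%N -> alpha = beta * (theta ^+ 2 +
  rho ^+ 2 * d n.+1 ^- 2 *
    (q n (v n.+1) (v n.+1) - 2 * (d n)^-1 * o n * q n (v n) (v n.+1))).

Let q_local0 m i j : (m < N)%N -> (i < N)%N -> (j < N)%N ->
  ~~ (m <= i <= m.+1)%N || ~~ (m <= j <= m.+1)%N -> q m (v i) (v j) = 0.
Proof.
by move=> mN iN jN h; apply/eqP/negP => /negP/(q_local mN iN jN); apply/negP; rewrite negb_and.
Qed.

Let Q n m := rho ^+ 2 * q m (psi n) (psi n).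

Let Fpsi n : (n < N)%N -> F (psi n).
Proof. exact: (dual_basis_test _ _ F_span). Qed.

Let Fv n : (n < N)%N -> F (v n).
Proof. exact: (test_basis F_span). Qed.

(** The form [q m] does not see the test functions supported before the
    interval [m], and [psi n] is one of them when [n < m]. *)
Lemma memory_future n m : (n < m < N)%N -> Q n m = 0.
Proof.
move=> /andP[nm mN]; have nN := ltn_trans nm mN.
rewrite /Q dual_basis_form_leading => [|i j i_n j_n _].
  by rewrite q_local0 ?mulr0// leqNgt nm.
by rewrite q_local0// ?(leq_ltn_trans _ nN)// leqNgt (leq_ltn_trans i_n nm).
Qed.

Lemma memory_diagonal n : (n < N)%N -> Q n n = 1 - beta^-1.
Proof.
move=> nN; rewrite /Q dual_basis_form_leading => [|i j i_n j_n ij].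
  by rewrite (betaE nN) opprB addrC subrK -invfM -expr2 mulrA.
rewrite q_local0// ?(leq_ltn_trans _ nN)//.
by lia.
Qed.

Lemma memory_step n m : (m <= n < M)%N -> Q n.+1 m = theta ^+ 2 * Q n m +
  rho ^+ 2 * d n.+1 ^- 2 *
    (q m (v n.+1) (v n.+1) - 2 * (d n)^-1 * o n * q m (v n) (v n.+1)).
Proof.
move=> /andP[mn nM]; have nN : (n < N)%N by exact: ltnW.
have mN := leq_ltn_trans mn nN.
rewrite /Q dual_basis_form_step => [|j jn]; last first.
  have jN := ltn_trans jn nN.
  by split; rewrite q_local0//; lia.
rewrite (thetaE nM) -/psi (q_sym mN (@Fv n.+1 nM) (Fv nN)).
by ring.
Qed.

(** For [m < n] the new hat function [v n.+1] lies beyond the reach of [q m],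
    so that passing from [psi n] to [psi n.+1] only scales the form. *)
Lemma memory_past n m : (m < n < M)%N -> Q n.+1 m = theta ^+ 2 * Q n m.
Proof.
move=> /andP[mn nM]; rewrite memory_step ?(ltnW mn)//.
have nN : (n < N)%N by exact: ltnW.
have mN := ltn_trans mn nN.
by rewrite !(@q_local0 m _ n.+1)// ?mulr0 ?subrr ?mulr0 ?addr0//; lia.
Qed.

(** This is where the formula for [alpha] comes from: [c n n] acts on
    [c n.+1 n.+1] with the factor [alpha], of which the share [theta ^+ 2] is
    inherited from its effect on the equation for [c n n] itself. *)
Lemma memory_subdiagonal n : (n < M)%N -> Q n.+1 n = beta^-1 * (alpha - theta ^+ 2).
Proof.
move=> nM; have nN : (n < N)%N by exact: ltnW.
rewrite memory_step ?leqnn// memory_diagonal// [in RHS](alphaE nM).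
by rewrite [RHS]mulrBr mulKf ?gt_eqF//; ring.
Qed.

(** The difference is a nonnegative multiple of a value of the positive
    semidefinite form [q 0]. *)
Lemma theta_sqr_le_alpha : (0 < M)%N -> theta ^+ 2 <= alpha.
Proof.
move=> M0; rewrite -subr_ge0.
have : 0 <= Q 1 0 by rewrite /Q mulr_ge0 ?sqr_ge0//; apply: q_ge0 => //; exact: Fpsi.
by rewrite memory_subdiagonal// pmulr_rge0// invr_gt0.
Qed.

Variable ell : {scalar W}.
Hypothesis ell_continuous : continuous (ell : W -> R).
Hypothesis ell_sym : forall y z, ell (tY y z) = ell (tY z y).
Hypothesis ell_ge0 : forall y, 0 <= ell (tY y y).
Variable c : nat -> nat -> R.
Let U := \sum_(m < N) \sum_(n < N) c m n *: tX (e m) (e n).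
Hypothesis U_eq : forall y z, F y -> F z ->
  B U (tY y z) - rho ^+ 2 * Delta U (tY y z) = ell (tY y z).

(** [Delta] annihilates the off-diagonal [tX (e m) (e n)] on the test space. *)
Lemma Delta_trace y z : F y -> F z ->
  Delta U (tY y z) = \sum_(m < N) c m m * q m y z.
Proof.
move=> Fy Fz; rewrite linear_sumlz; apply: eq_bigr => m _.
rewrite linear_sumlz (bigD1 m)//= big1 ?addr0 ?linearZl_LR// => n nm.
rewrite linearZl_LR/= (_ : Delta _ _ = 0) ?mulr0//.
move: Fy Fz; rewrite F_span => -[a _ <-] [a' _ <-].
rewrite linear_sumlz linear_sumr big1// => i _.
rewrite linear_sumr linear_sumr big1// => j _.
rewrite linearZl_LR linearZr_LR /= !linearZr_LR/= Delta_diagonal//; last by rewrite eq_sym.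
by rewrite /GRing.scale/= ?mulr0.
Qed.

(** Biorthogonality extracts the coefficient from [B U]. *)
Lemma coefE m n : (m < N)%N -> (n < N)%N ->
  c m n = ell (tY (psi m) (psi n)) + rho ^+ 2 * \sum_(k < N) c k k * q k (psi m) (psi n).
Proof.
move=> mN nN; have Fm := Fpsi mN; have Fn := Fpsi nN.
rewrite -Delta_trace// -U_eq// subrK.
have bE j k : (j < N)%N -> (k < N)%N -> b (e j) (psi k) = (j == k)%:R.
  exact: (dual_biorthogonal e_orthonormal A_span F_span).
rewrite /U linear_sumlz (bigD1 (Ordinal mN))//= [X in _ + X]big1 => [|j jm].
  rewrite addr0 linear_sumlz (bigD1 (Ordinal nN))//= big1 => [|k kn].
    by rewrite linearZl_LR/= B_elementary !bE// !eqxx !mulr1 addr0.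
  move: kn; rewrite -val_eqE => /negbTE kn.
  by rewrite linearZl_LR/= B_elementary !bE// kn !mulr0.
move: jm; rewrite -val_eqE => /negbTE jm.
rewrite linear_sumlz big1// => k _.
by rewrite linearZl_LR/= B_elementary !bE// jm mul0r mulr0.
Qed.

Let l n := ell (tY (psi n) (psi n)).

Lemma diag_recursion :
  c 0 0 = beta * l 0%N /\
  forall n, (n < M)%N -> c n.+1 n.+1 = alpha * c n n + beta * (l n.+1 - theta ^+ 2 * l n).
Proof.
apply: (@memory_collapse _ M alpha beta theta (fun n => c n n) l Q).
- by rewrite gt_eqF.
- by move=> n m; exact: memory_future.
- exact: memory_diagonal.
- by move=> n m; exact: memory_past.
- exact: memory_subdiagonal.
- move=> n nN; rewrite {1}coefE//; congr (_ + _); rewrite mulr_sumr.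
  by apply: eq_bigr => m _; rewrite mulrCA.
Qed.

Lemma diag_bound :
  (forall n, (n < N)%N -> 0 <= c n n) /\
  \sum_(n < N) c n n <=
    beta * (1 + (alpha - theta ^+ 2) * \sum_(i < M) alpha ^+ i) * \sum_(n < N) l n.
Proof.
have [c0 cS] := diag_recursion.
apply: (@recursion_bound _ M alpha beta theta (fun n => c n n)) => //.
- exact: theta_sqr_le_alpha.
- by move=> n; exact: ell_ge0.
Qed.

Lemma coef_sym m n : (m < N)%N -> (n < N)%N -> c m n = c n m.
Proof.
move=> mN nN; have Fm := Fpsi mN; have Fn := Fpsi nN.
rewrite !coefE// ell_sym; congr (_ + _ * _); apply: eq_bigr => k _.
by rewrite q_sym.
Qed.

(** The quadratic form of the coefficients at [x] is the right-hand side of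
    [coefE] at the test function [\sum_m x m *: psi m]; both of its terms are
    nonnegative, since the diagonal coefficients are. *)
Lemma coef_psd (x : nat -> R) :
  0 <= \sum_(m < N) \sum_(n < N) x m * x n * c m n.
Proof.
pose y := \sum_(m < N) x m *: psi m.
have expand (g : {bilinear Y -> Y -> R | *%R & *%R}) :
    \sum_(m < N) \sum_(n < N) x m * x n * g (psi m) (psi n) = g y y.
  rewrite linear_sumlz; apply: eq_bigr => m _; rewrite linearZl_LR/= linear_sumr mulr_sumr.
  by apply: eq_bigr => n _; rewrite linearZr_LR/= mulrA.
have Fy : F y.
  rewrite /y; elim/big_ind: _ => [|y1 y2 F1 F2|m _]; first exact: (test_0 F_span).
    by rewrite -[y1]scale1r; apply: (test_comb F_span).
  by rewrite -[_ *: _]addr0; apply: (test_comb F_span); [exact: Fpsi|exact: (test_0 F_span)].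
have -> : \sum_(m < N) \sum_(n < N) x m * x n * c m n =
    ell (tY y y) + rho ^+ 2 * \sum_(k < N) c k k * q k y y.
  rewrite -[ell _]/(tensor_form tY ell y y) -expand.
  under [X in _ + _ * X]eq_bigr do rewrite -expand mulr_sumr.
  rewrite [X in _ + _ * X]exchange_big mulr_sumr -big_split; apply: eq_bigr => m _ /=.
  under [X in _ + _ * X]eq_bigr do rewrite mulr_sumr.
  rewrite [X in _ + _ * X]exchange_big mulr_sumr -big_split; apply: eq_bigr => n _ /=.
  rewrite coefE// mulrDr. congr (_ + _).
  rewrite mulrCA mulr_sumr; congr (_ * _).
  by apply: eq_bigr => k _; rewrite mulrCA.
rewrite addr_ge0// mulr_ge0 ?sqr_ge0// sumr_ge0// => k _.
by rewrite mulr_ge0 ?diag_bound.1// q_ge0.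
Qed.

(** A Gram factorization of the coefficients represents [U] as a sum of squares
    of vectors [u i], and by orthonormality the sum of the [`|u i| ^+ 2] is
    the trace. *)
Lemma projective_norm_le_trace : `|U| <= \sum_(n < N) c n n.
Proof.
(* [psd_factor] wants symmetry for all indices, but [c] is only constrained
   below [N]. *)
pose cs m n := if (m < N)%N && (n < N)%N then c m n else 0.
have csE (m n : 'I_N) : cs m n = c m n by rewrite /cs !ltn_ord.
have [||L LE] := @psd_factor R N cs.
- move=> j k; rewrite /cs andbC; case: ifP => // /andP[kN jN]; exact: coef_sym.
- move=> x; under eq_bigr do under eq_bigr do rewrite csE; exact: coef_psd.
pose u i := \sum_(m < N) L i m *: e m.
have -> : U = tsum tX [seq (u i, u i) | i : 'I_N].
  rewrite /tsum big_image/= /U.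
  transitivity (\sum_(m < N) \sum_(n < N) \sum_(i < N) (L i m * L i n) *: tX (e m) (e n)).
    apply: eq_bigr => m _; apply: eq_bigr => n _.
    by rewrite -csE LE// scaler_suml.
  rewrite (eq_bigr (fun m : 'I_N => \sum_(i < N) \sum_(n < N) (L i m * L i n) *: tX (e m) (e n)));
    last by move=> m _; rewrite exchange_big.
  rewrite exchange_big; apply: eq_bigr => i _.
  rewrite linear_sumlz; apply: eq_bigr => m _; rewrite linearZl_LR linear_sumr scaler_sumr.
  by apply: eq_bigr => n _; rewrite linearZr_LR scalerA.
apply: (le_trans (projective_norm_le _ tX_projective)).
rewrite big_image/= (eq_bigr (fun i : 'I_N => \sum_(m < N) L i m ^+ 2)); last first.
  by move=> i _; rewrite -expr2 e_orthonormal.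
rewrite exchange_big; apply: ler_sum => m _.
by rewrite -csE LE//; apply: ler_sum => i _; rewrite expr2.
Qed.

(** The trace bounds the projective norm, the recursion bounds the trace by the
    sum of the [l n], and that sum is [ell] at the diagonal tensor of the dual
    basis. *)
Theorem solution_bound :
  `|U| <= infsup b A F ^- 2 * beta *
    (1 + (alpha - theta ^+ 2) * \sum_(i < M) alpha ^+ i) * dual_norm ell.
Proof.
apply: (le_trans projective_norm_le_trace); apply: (le_trans diag_bound.2).
have s0 : 0 <= (alpha - theta ^+ 2) * \sum_(i < M) alpha ^+ i.
  have [M0|M0] := posnP M; first by rewrite M0 big_ord0 mulr0.
  have at2 := theta_sqr_le_alpha M0.
  rewrite mulr_ge0 ?subr_ge0// sumr_ge0// => i _.
  by rewrite exprn_ge0// (le_trans (sqr_ge0 _) at2).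
rewrite -!mulrA [leRHS]mulrCA ler_pM2l// [leRHS]mulrCA ler_wpM2l ?addr_ge0//.
have -> : \sum_(n < N) l n = ell (\sum_(n < N) tY (psi n) (psi n)) by rewrite linear_sum.
apply: (le_trans (ler_norm _)); apply: (le_trans (dual_norm_bound _ ell_continuous)).
rewrite mulrC ler_wpM2r ?dual_norm_ge0//.
exact: (dual_diagonal_norm e_orthonormal A_span F_span).
Qed.

End stability.

(** * Square integrable functions *)

Section square_integrable.
Context d (T : measurableType d) (R : realType).
Variable mu : {measure set T -> \bar R}.
Implicit Types f g h : T -> R.

Lemma Lfun_measurable (p : \bar R) f : f \in Lfun mu p -> measurable_fun setT f.
Proof. by rewrite inE => /andP[/[!inE]/=]. Qed.

Lemma integrable_mul f g : f \in Lfun mu 2%:E -> g \in Lfun mu 2%:E ->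
  mu.-integrable setT (EFin \o (fun x => f x * g x)).
Proof. by move=> f2 g2; apply/Lfun1_integrable; exact: Lfun2_mul_Lfun1. Qed.

Lemma Lfun2_comb a f g : f \in Lfun mu 2%:E -> g \in Lfun mu 2%:E ->
  (fun x => a * f x + g x) \in Lfun mu 2%:E.
Proof. by move=> f2 g2; exact: (Lfun_submod_closed mu (lee1n 2)).2. Qed.

Lemma ae_eq_Rintegral f g : measurable_fun setT f -> measurable_fun setT g ->
  f = g %[ae mu] -> \int[mu]_x f x = \int[mu]_x g x.
Proof.
move=> mf mg fg; congr fine; apply: ae_eq_integral => //; first exact/measurable_EFinP.
  exact/measurable_EFinP.
by apply: filterS fg => x /= /[apply] ->.
Qed.

Lemma Rintegral_comb a f g : mu.-integrable setT (EFin \o f) ->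
  mu.-integrable setT (EFin \o g) ->
  \int[mu]_x (a * f x + g x) = a * \int[mu]_x f x + \int[mu]_x g x.
Proof.
move=> If Ig; rewrite -RintegralZl// -RintegralD//.
rewrite (_ : _ \o _ = fun x => a%:E * (EFin \o f) x)%E; first exact: integrableZl.
by apply/funext => x; rewrite /= EFinM.
Qed.

Lemma Rintegral_mul_comb a h f1 f2 f : h \in Lfun mu 2%:E ->
  f1 \in Lfun mu 2%:E -> f2 \in Lfun mu 2%:E -> f \in Lfun mu 2%:E ->
  f = (fun x => a * f1 x + f2 x) %[ae mu] ->
  \int[mu]_x (h x * f x) = a * \int[mu]_x (h x * f1 x) + \int[mu]_x (h x * f2 x).
Proof.
move=> h2 f12 f22 fL fE; rewrite -Rintegral_comb; [|exact: integrable_mul..].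
have mm := Lfun_measurable.
apply: ae_eq_Rintegral; first by apply: measurable_funM; apply: mm; eassumption.
  by apply: measurable_funD; [apply: measurable_funM => //|];
    apply: measurable_funM; apply: mm; eassumption.
by apply: filterS fE => x fx xT; rewrite fx//; ring.
Qed.

Lemma L2_fun_comb a (f g : L2 mu) :
  L2_fun (a *: f + g) = (fun x => a * L2_fun f x + L2_fun g x) %[ae mu].
Proof.
apply: (filterS _ (filterI (L2_funD (a *: f) g) (L2_funZ a f))).
by move=> x [fg fa] xT; rewrite fg//= fa.
Qed.

Lemma L2norm_sqr f : f \in Lfun mu 2%:E -> L2norm mu f ^+ 2 = \int[mu]_x (f x * f x).
Proof.
move=> f2; rewrite /L2norm unlock /Rintegral.
have -> : (\int[mu]_x (`|(EFin \o f) x| `^ 2) = \int[mu]_x (f x * f x)%:E)%E.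
  apply: eq_integral => x _ /=.
  by rewrite powR_mulrn// real_normK ?num_real// expr2.
have If := integrable_mul f2 f2.
have fin := integrable_fin_num measurableT If.
have I0 : (0 <= \int[mu]_x (f x * f x)%:E)%E.
  by apply: integral_ge0 => x _; rewrite lee_fin -expr2 sqr_ge0.
rewrite -(fineK fin) poweR_EFin/= -powR_mulrn ?powR_ge0// -powRrM.
by rewrite mulVf ?powRr1 ?fine_ge0// pnatr_eq0.
Qed.

End square_integrable.

Section vanishing.
Context (R : realType) (mu : {finite_measure set (measurableTypeR R) -> \bar R}).

(** The half-open intervals form a pi-system that generates the Borel sets, so
    the integral of [g] over every Borel subset of [`]a, b]] vanishes, and [g]
    with it. *)
Lemma ae0_of_itv_integrals (g : R -> R) (a b : R) :
  mu.-integrable setT (EFin \o g) ->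
  (forall s t, a <= s -> s <= t -> t <= b -> \int[mu]_(x in `]s, t]) g x = 0) ->
  {ae mu, forall x, `]a, b]%classic x -> g x = 0}.
Proof.
move=> Ig g0.
pose D : set (measurableTypeR R) := `]a, b]%classic.
have mD : measurable D by exact: measurable_itv.
have Ig' E : measurable E -> mu.-integrable E (EFin \o g).
  by move=> mE; exact: integrableS Ig.
have gI s t : a <= s -> t <= b -> (\int[mu]_(x in `]s, t]%classic) (g x)%:E = 0)%E.
  move=> as_ tb; have [st|ts] := leP s t; last first.
    by rewrite set_itv_ge ?integral_set0// bnd_simp -leNgt ltW.
  rewrite -[LHS]fineK; first by congr EFin; exact: g0.
  by apply: integrable_fin_num => //; apply: Ig'; exact: measurable_itv.
have key E : measurable E -> (\int[mu]_(x in E `&` D) (g x)%:E = 0)%E.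
  move: E; apply: (@dynkin_induction _ (measurableTypeR R) (@ocitv R)
      (fun E => (\int[mu]_(x in E `&` D) (g x)%:E = 0)%E)) => //.
  - exact: ocitvI.
  - by rewrite setTI; exact: gI.
  - move=> _ [[s t] _ <-] /=.
    rewrite (_ : _ `&` D = `]Num.max s a, Num.min t b]%classic); last first.
      apply/seteqP; split=> x; rewrite /D/= !in_itv/= gt_max le_min.
        by move=> [/andP[-> ->] /andP[-> ->]].
      by move=> /andP[/andP[-> ->] /andP[-> ->]].
    by apply: gI; rewrite ?le_max ?ge_min lexx orbT.
  - move=> S mS S0; have mSC := measurableC mS.
    have : (\int[mu]_(x in (S `&` D) `|` (~` S `&` D)) (g x)%:E = 0)%E.
      by rewrite -setIUl setUv setTI; exact: gI.
    rewrite integral_setU ?S0 ?add0e//; try exact: measurableI.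
      by apply: (measurable_int mu); apply: Ig'; apply: measurableU; exact: measurableI.
    by apply/disj_setPS => x [[Sx _] [/(_ Sx)]].
  - move=> F mF tF F0.
    rewrite setI_bigcupl integral_bigcup => [|||].
    + by rewrite eseries0// => k _ _; exact: F0.
    + exact: trivIset_setIr.
    + by move=> k; exact: measurableI.
    + by apply: Ig'; apply: bigcupT_measurable => k; exact: measurableI.
have : ae_eq mu D (EFin \o g) (cst 0%E).
  apply: integral_ae_eq => //; first exact: Ig'.
  move=> E ED mE; rewrite integral0 -[in LHS](setIidl ED); exact: key.
by apply: filterS => x /= h /h [].
Qed.
End vanishing.

(** * The trial and test spaces *)

#[local] Instance muJ_ae_filter (R : realType) (T : R) :
  Filter (almost_everywhere (muJ T)) := ae_filter_ringOfSetsType (muJ T).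

Section spaces.
Variables (R : realType) (lambda : {posnum R}) (T : R).
Local Notation E := (Espace lambda T).
Local Notation F := (Fspace lambda T).
Local Notation mu := (muJ T).

Definition E_inner (w z : E) : R := \int[mu]_x (E_fun w x * E_fun z x).

Lemma E_Lfun (w : E) : E_fun w \in Lfun mu 2%:E.
Proof. exact: L2_Lfun. Qed.

Lemma E_innerC w z : E_inner w z = E_inner z w.
Proof. by congr fine; apply: eq_integral => x _; rewrite mulrC. Qed.

Lemma E_inner_bilinear : bilinear_for
  (GRing.Scale.Law.clone R R *%R _) (GRing.Scale.Law.clone R R *%R _) E_inner.
Proof.
have lin (z : E) : scalar (E_inner z).
  move=> a w1 w2; apply: Rintegral_mul_comb; do ?exact: E_Lfun.
  exact: L2_fun_comb.
by split=> z a w1 w2 /=; rewrite ?(E_innerC _ z) lin.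
Qed.
HB.instance Definition _ := bilinear_isBilinear.Build R E E R
  (GRing.Scale.Law.clone R R *%R _) (GRing.Scale.Law.clone R R *%R _)
  E_inner E_inner_bilinear.

Lemma E_norm_sqr (w : E) : `|w| ^+ 2 = lambda%:num * E_inner w w.
Proof.
rewrite [`|w|]/(normE w) exprMn sqr_sqrtr//; congr (_ * _).
by apply: L2norm_sqr; exact: E_Lfun.
Qed.

Lemma F_deriv_Lfun (v : F) : F_deriv v \in Lfun mu 2%:E.
Proof. exact: L2_Lfun. Qed.

Definition F_adjoint (v : F) (x : R) : R := - F_deriv v x + lambda%:num * F_fun v x.

Lemma F_adjoint_Lfun (v : F) : F_adjoint v \in Lfun mu 2%:E.
Proof.
have -> : F_adjoint v = fun x => -1 * F_deriv v x + (lambda%:num * F_fun v x + 0).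
  by apply/funext => x; rewrite /F_adjoint mulN1r addr0.
apply: Lfun2_comb; first exact: F_deriv_Lfun.
by apply: Lfun2_comb; [exact: F_Lfun|exact: Lfun_cst].
Qed.

Lemma F_deriv_comb a (u v : F) :
  F_deriv (a *: u + v) = (fun x => a * F_deriv u x + F_deriv v x) %[ae mu].
Proof. exact: L2_fun_comb. Qed.

(** Bilinearity holds almost everywhere under the integral sign only: both the
    trial functions and the derivatives are classes of functions. *)
Lemma bform_bilinear : bilinear_for
  (GRing.Scale.Law.clone R R *%R _) (GRing.Scale.Law.clone R R *%R _) (@bform R lambda T).
Proof.
split=> [v a w1 w2|w a u v] /=.
  have swap w : bform w v = \int[mu]_x (F_adjoint v x * E_fun w x).
    by congr fine; apply: eq_integral => x _; rewrite mulrC.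
  rewrite !swap; apply: Rintegral_mul_comb; do ?exact: E_Lfun.
    exact: F_adjoint_Lfun.
  exact: L2_fun_comb.
apply: Rintegral_mul_comb; do ?exact: F_adjoint_Lfun; first exact: E_Lfun.
apply: filterS (F_deriv_comb a u v) => x uv xT.
by rewrite /F_adjoint uv// F_funD F_funZ; ring.
Qed.
HB.instance Definition _ := bilinear_isBilinear.Build R E F R
  (GRing.Scale.Law.clone R R *%R _) (GRing.Scale.Law.clone R R *%R _)
  (@bform R lambda T) bform_bilinear.

Lemma ae_muJ : {ae mu, forall x, 0 < x < T}.
Proof.
have mJ : measurable (`]0, T[%classic : set (measurableTypeR R)) by exact: measurable_itv.
exists (~` `]0, T[%classic); split; first exact: measurableC.
  by rewrite /muJ /mfrestr /mrestr setICl measure0.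
by move=> x /=; rewrite in_itv.
Qed.

Lemma F_increment (u : F) s t : s <= t ->
  \int[mu]_(x in `]s, t]) F_deriv u x = F_fun u t - F_fun u s.
Proof. by case/FgraphP: (valP u) => _ uI _ /uI. Qed.

Lemma F_fun_end (u : F) : F_fun u T = 0.
Proof. by case/FgraphP: (valP u). Qed.

(** The increments of [u] are the integrals of its derivative, so these vanish
    over every subinterval of [`]a, b]]. *)
Lemma F_deriv_ae0 (u : F) a b : (forall x, a <= x <= b -> F_fun u x = 0) ->
  {ae mu, forall x, a < x <= b -> F_deriv u x = 0}.
Proof.
move=> u0; apply: ae0_of_itv_integrals => [|s t as_ st tb].
  exact: L2_integrable.
rewrite F_increment// !u0 ?subrr//; first by rewrite as_ (le_trans st).
by rewrite (le_trans as_ st).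
Qed.

Lemma F_eq0 (u : F) : 0 <= T -> (forall x, 0 <= x <= T -> F_fun u x = 0) -> u = 0.
Proof.
move=> T0 u0; apply: normF_eq0.
have L20 f : f \in Lfun mu 2%:E -> f = cst 0 %[ae mu] -> L2norm mu f = 0.
  move=> f2 f0; apply/eqP; rewrite -sqrf_eq0 L2norm_sqr//.
  rewrite (@ae_eq_Rintegral _ _ _ _ _ (cst 0)); first by rewrite /Rintegral integral0.
  - by apply: measurable_funM; exact: Lfun_measurable f2.
  - exact: measurable_cst.
  - by apply: filterS f0 => x fx xT; rewrite fx//= mul0r.
have d0 := F_deriv_ae0 u0.
rewrite /normF !L20; do ?[exact: F_deriv_Lfun|exact: F_Lfun].
- by rewrite u0 ?lexx// expr0n/= !mulr0 !addr0 sqrtr0.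
- by apply: filterS ae_muJ => x /andP[x0 xT] _; rewrite u0// !ltW.
- by apply: (filterS _ (filterI ae_muJ d0)) => x [/andP[x0 xT] dx] _; rewrite dx// x0 ltW.
Qed.

(** The double integral against [phi] is the square of the integral of
    [w * phi]; square integrability on the product is Tonelli's theorem. *)
Lemma elementary_square_spsd (Epi : completeNormedModType R)
  (tE : {bilinear E -> E -> Epi}) (w : E) : spsd_tensor tE (tE w w).
Proof.
exists [:: (w, w)]; split; first by rewrite /tsum big_seq1.
have kE x y : kernel_of [:: (w, w)] x y = E_fun w x * E_fun w y by rewrite /kernel_of big_seq1.
have mw := L2_measurable (w : L2 mu).
have Iw2 := integrable_mul (E_Lfun w) (E_Lfun w).
split.
- rewrite inE; apply/andP; split; rewrite inE/=.
    under eq_fun do rewrite kE.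
    apply: measurable_funM; exact: measurableT_comp.
  rewrite /finite_norm unlock; apply: poweR_lty.
  have w0 x : (0 <= (E_fun w x * E_fun w x)%:E)%E by rewrite lee_fin -expr2 sqr_ge0.
  have mw2 : measurable_fun setT (fun x => E_fun w x * E_fun w x) by exact: measurable_funM.
  rewrite (eq_integral (fun p : measurableTypeR R * measurableTypeR R =>
      (E_fun w p.1 * E_fun w p.1)%:E *
      (E_fun w p.2 * E_fun w p.2)%:E))%E; last first.
    move=> p _ /=; rewrite kE powR_mulrn// real_normK ?num_real//.
    by rewrite -EFinM; congr EFin; ring.
  rewrite fubini_tonelli1/=; last 2 first.
  - apply: emeasurable_funM; apply/measurable_EFinP.
      exact: (measurableT_comp mw2 measurable_fst).
    exact: (measurableT_comp mw2 measurable_snd).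
  - by move=> p; exact: mule_ge0.
  have fin := integrable_fin_num measurableT Iw2.
  rewrite /fubini_F /= (eq_integral (fun x : measurableTypeR R =>
      (\int[mu]_y (E_fun w y * E_fun w y)%:E) *
      (E_fun w x * E_fun w x)%:E))%E; last first.
    move=> x _; rewrite ge0_integralZl//; first by rewrite muleC.
    exact/measurable_EFinP.
  rewrite ge0_integralZl//; last by apply: integral_ge0 => y _.
    by rewrite ltey_eq fin_numM.
  exact/measurable_EFinP.
- by apply: aeW => -[x y]; rewrite !kE mulrC.
- move=> phi.
  pose I := \int[mu]_x (E_fun w x * L2_fun phi x).
  have Iphi := integrable_mul (E_Lfun w) (L2_Lfun phi).
  have inner s : \int[mu]_x (kernel_of [:: (w, w)] s x * L2_fun phi s * L2_fun phi x) =
      I * (E_fun w s * L2_fun phi s).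
    rewrite [RHS]mulrC -RintegralZl//; congr fine; apply: eq_integral => x _.
    by rewrite kE; congr EFin; ring.
  under eq_Rintegral do rewrite inner.
  by rewrite RintegralZl// -expr2 sqr_ge0.
Qed.

End spaces.

(** * Functions on the mesh *)

Section mesh.
Variables (R : realType) (lambda : {posnum R}) (T : R) (N : nat) (t : nat -> R).
Local Notation E := (Espace lambda T).
Local Notation F := (Fspace lambda T).
Local Notation mu := (muJ T).
Hypothesis t_mesh : is_mesh T N t.

Lemma mesh_step n : (n < N)%N -> t n < t n.+1.
Proof. by case: t_mesh => _ _ h nN; have := h n.+1; apply. Qed.

Lemma mesh_le m n : (m <= n <= N)%N -> t m <= t n.
Proof.
elim: n => [|n IH]; first by rewrite leqn0 => /andP[/eqP ->].
rewrite leq_eqVlt => /andP[/orP[/eqP -> //|mn] nN].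
by apply: le_trans (ltW (mesh_step nN)); apply: IH; lia.
Qed.

Lemma Fk_comb a (u v : F) : Fk N t u -> Fk N t v -> Fk N t (a *: u + v).
Proof.
move=> Fu Fv n nN; have [a1 [c1 h1]] := Fu n nN; have [a2 [c2 h2]] := Fv n nN.
exists (a * a1 + a2), (a * c1 + c2) => x xt.
by rewrite F_funD F_funZ h1// h2//; ring.
Qed.

Lemma Fk_sum (c : nat -> R) (v : nat -> F) M : (forall i, (i < M)%N -> Fk N t (v i)) ->
  Fk N t (\sum_(i < M) c i *: v i).
Proof.
move=> Fv; elim/big_rec: _ => [|i u _]; last by apply: Fk_comb; exact: Fv.
by move=> n _; exists 0, 0 => x _; rewrite mul0r addr0.
Qed.

Lemma Fk_eq0_on n (u : F) : (n < N)%N -> Fk N t u ->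
  F_fun u (t n) = 0 -> F_fun u (t n.+1) = 0 ->
  forall x, t n <= x <= t n.+1 -> F_fun u x = 0.
Proof.
move=> nN Fu u1 u2 x xt; have [//|a [c h]] := Fu n.+1; rewrite /= in h.
have tn := mesh_step nN.
move: u1 u2; rewrite !h ?lexx ?(ltW tn)// => u1 u2.
have /eqP : a * (t n.+1 - t n) = 0 by rewrite mulrBr; lra.
rewrite mulf_eq0 subr_eq0 (gt_eqF tn) orbF => /eqP a0.
by move: u1; rewrite a0 !mul0r.
Qed.

Lemma F_sum_fun (c : nat -> R) (v : nat -> F) M x :
  F_fun (\sum_(i < M) c i *: v i) x = \sum_(i < M) c i * F_fun (v i) x.
Proof.
elim/big_rec2: _ => // i y u _ <-; by rewrite F_funD F_funZ.
Qed.

(** A function of the test space is the interpolant of its nodal values: the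
    difference is affine with zero nodal values on every mesh interval. *)
Lemma Fk_span (v : nat -> F) : 0 <= T -> is_hat_basis N t v ->
  Fk N t = range (fun c : nat -> R => \sum_(i < N) c i *: v i).
Proof.
move=> T0 hat; have [t0 tN _] := t_mesh.
have sumE (c : nat -> R) j : (j <= N)%N ->
    F_fun (\sum_(i < N) c i *: v i) (t j) = if (j < N)%N then c j else 0.
  move=> jN; rewrite F_sum_fun; case: ifP => jN'.
    rewrite (bigD1 (Ordinal jN'))//= (hat _ jN').2// eqxx mulr1 big1 ?addr0// => i.
    by rewrite -val_eqE/= => /negbTE ij; rewrite (hat i _).2// ij mulr0.
  by rewrite big1// => i _; rewrite (hat i _).2// ltn_eqF ?mulr0// (leq_trans (ltn_ord i))// leqNgt jN'.
apply/seteqP; split=> [y Fy|_ [c _ <-]]; last by apply: Fk_sum => i /hat[].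
exists (fun i => F_fun y (t i)) => //.
set z := \sum_(i < N) _.
apply/esym/eqP; rewrite -subr_eq0; apply/eqP/F_eq0 => //.
have Fu : Fk N t (y - z).
  rewrite addrC -scaleN1r; apply: Fk_comb => //; apply: (Fk_sum (fun i => F_fun y (t i))) => i /hat[] //.
have uE j : (j <= N)%N -> F_fun (y - z) (t j) = 0.
  move=> jN; rewrite -scaleN1r F_funD F_funZ (sumE (fun i => F_fun y (t i)))//.
  case: ifP => jN'; first by rewrite mulN1r subrr.
  have -> : j = N by lia.
  by rewrite tN F_fun_end mulr0 addr0.
suff H n : (n <= N)%N -> forall x, 0 <= x <= t n -> F_fun (y - z) x = 0.
  by move=> x; have := H N (leqnn N) x; rewrite tN.
elim: n => [|n IH] nN x.
  by have := uE 0%N nN; rewrite t0 => u0 /le_anti <-.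
move=> /andP[x0 xn]; have [xtn|tnx] := leP x (t n).
  by apply: IH; [exact: ltnW|rewrite x0].
apply: (@Fk_eq0_on n) => //; do ?[exact: uE|by rewrite (ltW tnx)].
by apply: uE; exact: ltnW.
Qed.

Variables (sch : scheme) (e : nat -> E).
Hypothesis e_trial : is_trial_basis N t sch e.

Lemma trial_support n : (n < N)%N ->
  {ae mu, forall x, ~~ (t n < x < t n.+1) -> E_fun (e n.+1) x = 0}.
Proof.
move=> nN; have [//|c _ he] := e_trial (n := n.+1).
apply: filterS he => x -> xt /=.
by rewrite indicE memNset ?mulr0//= in_itv; exact/negP.
Qed.

(** The trial function vanishes outside its mesh interval, and inside it both
    [u] and its derivative vanish almost everywhere. *)
Lemma bform_trial_eq0 n (u : F) : (n < N)%N ->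
  (forall x, t n <= x <= t n.+1 -> F_fun u x = 0) -> bform (e n.+1) u = 0.
Proof.
move=> nN u0; rewrite /bform (@ae_eq_Rintegral _ _ _ _ _ (cst 0)).
- by rewrite /Rintegral integral0.
- apply: measurable_funM; first exact: Lfun_measurable (E_Lfun _).
  exact: Lfun_measurable (F_adjoint_Lfun u).
- exact: measurable_cst.
- apply: (filterS _ (filterI (trial_support nN) (F_deriv_ae0 u0))) => x [ex dx] _.
  have [xt|/ex ->] := boolP (t n < x < t n.+1); last by rewrite mul0r.
  case/andP: xt => x1 x2.
  by rewrite dx ?x1 ?(ltW x2)// u0 ?(ltW x1) ?(ltW x2)// mulr0 oppr0 addr0 mulr0.
Qed.

Lemma bform_hat_eq0 (v : nat -> F) m i : is_hat_basis N t v -> (m < N)%N -> (i < N)%N ->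
  i != m -> i != m.+1 -> bform (e m.+1) (v i) = 0.
Proof.
move=> hat mN iN im im1; apply: bform_trial_eq0 => //.
have [Fv vt] := hat i iN.
apply: Fk_eq0_on => //; rewrite vt ?(negbTE im) ?(negbTE im1)//; exact: ltnW.
Qed.

Lemma trial_inner_eq0 m n : (m < n < N)%N -> E_inner (e m.+1) (e n.+1) = 0.
Proof.
move=> /andP[mn nN]; have mN := ltn_trans mn nN.
rewrite /E_inner (@ae_eq_Rintegral _ _ _ _ _ (cst 0)).
- by rewrite /Rintegral integral0.
- by apply: measurable_funM; exact: Lfun_measurable (E_Lfun _).
- exact: measurable_cst.
- apply: (filterS _ (filterI (trial_support mN) (trial_support nN))) => x [em en] _.
  have [xt|/em ->] := boolP (t m < x < t m.+1); last by rewrite mul0r.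
  rewrite en ?mulr0//.
  have : t m.+1 <= t n by apply: mesh_le; lia.
  by case/andP: xt; lra.
Qed.

Lemma trial_orthonormal (c : nat -> R) : (forall n, (1 <= n <= N)%N -> `|e n| = 1) ->
  `|\sum_(i < N) c i *: e i.+1| ^+ 2 = \sum_(i < N) c i ^+ 2.
Proof.
move=> e1; rewrite E_norm_sqr linear_sumlz mulr_sumr; apply: eq_bigr => i _.
have innerZ a b (w z : E) : E_inner (a *: w) (b *: z) = a * b * E_inner w z.
  by rewrite linearZl_LR linearZr_LR /GRing.scale/= mulrA.
rewrite linear_sumr (bigD1 i)//= big1 ?addr0 => [|j ji].
  rewrite innerZ mulrCA -E_norm_sqr e1 ?expr1n; last by have := ltn_ord i; lia.
  by rewrite mulr1 expr2.
rewrite innerZ; move: ji; rewrite -val_eqE/= neq_ltn => /orP[ji|ij].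
  by rewrite E_innerC trial_inner_eq0 ?mulr0// ji ltn_ord.
by rewrite trial_inner_eq0 ?mulr0// ij ltn_ord.
Qed.

End mesh.

(** * The stability bound *)

(** Both branches of the constant are the sum of a geometric progression, which
    degenerates at [alpha = 1]. *)
Lemma stability_constant_geometric (R : realType) M (gamma alpha beta theta : R) :
  stability_constant M.+1 gamma alpha beta theta =
  gamma ^- 2 * beta * (1 + (alpha - theta ^+ 2) * \sum_(i < M) alpha ^+ i).
Proof.
rewrite /stability_constant; case: eqVneq => [->|al1].
  rewrite (eq_bigr (fun=> 1)) => [|i _]; last by rewrite expr1n.
  by rewrite sumr_const card_ord -[M.+1]addn1 natrD; congr (_ * _); ring.
have -> // : (alpha ^+ M - 1) / (alpha - 1) = \sum_(i < M) alpha ^+ i.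
by rewrite subrX1 mulrAC mulfV ?subr_eq0// mul1r.
Qed.

Lemma Ek_span (R : realType) (lambda : {posnum R}) (T : R) N (e : nat -> Espace lambda T) :
  Ek N e = range (fun c : nat -> R => \sum_(i < N) c i *: e i.+1).
Proof.
apply/seteqP; split=> _ [c _ <-].
  by exists (fun i => c i.+1) => //; rewrite big_add1/= big_mkord.
by exists (fun i => c i.-1) => //; rewrite big_add1/= big_mkord.
Qed.

Theorem theorem3p8 (R : realType) (T : R) (lambda : {posnum R}) (rho : R)
  (T_gt0 : 0 < T) (rho_ge0 : 0 <= rho)
  (Epi Feps : completeNormedModType R)
  (tE : {bilinear Espace lambda T -> Espace lambda T -> Epi})
  (tF : {bilinear Fspace lambda T -> Fspace lambda T -> Feps})
  (tE_projective : is_projective_tensor tE)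
  (tF_injective : is_injective_tensor tF)
  (B : {bilinear Epi -> Feps -> R | *%R & *%R})
  (B_continuous : continuous (fun p : Epi * Feps => B p.1 p.2))
  (B_elementary : forall w1 w2 v1 v2,
     B (tE w1 w2) (tF v1 v2) = bform w1 v1 * bform w2 v2)
  (N : nat) (t : nat -> R) (t_mesh : is_mesh T N t)
  (v : nat -> Fspace lambda T) (v_hat : is_hat_basis N t v)
  (sch : scheme)
  (e : nat -> Espace lambda T) (e_trial : is_trial_basis N t sch e)
  (gamma_gt0 : 0 < infsup (@bform R lambda T) (Ek N e) (Fk N t))
  (Delta : {bilinear Epi -> Feps -> R | *%R & *%R})
  (Delta_continuous : continuous (fun p : Epi * Feps => Delta p.1 p.2))
  (Delta_spsd : forall w, tensor_sub tE (Ek N e) (Ek N e) w -> spsd_tensor tE w ->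
     forall psi psi', Fk N t psi -> Fk N t psi' ->
       Delta w (tF psi psi') = Delta w (tF psi' psi) /\
       0 <= Delta w (tF psi psi))
  (Delta_sparse : forall m n i j, (1 <= m <= N)%N -> (1 <= n <= N)%N ->
     (i < N)%N -> (j < N)%N -> Delta (tE (e m) (e n)) (tF (v i) (v j)) != 0 ->
     [/\ m = n, i \in [:: n.-1; n] & j \in [:: n.-1; n]])
  (t_uniform : uniform_mesh T N t) (e_scaled : uniform_scaling N t e)
  (alpha beta theta : R) :
  let b i n := bform (e n) (v i) in
  let D n i j := Delta (tE (e n) (e n)) (tF (v i) (v j)) in
  (forall n, (1 <= n <= N)%N -> 0 < beta_n rho b D n) ->
  (forall n, (1 <= n <= N)%N -> beta_n rho b D n = beta) ->
  (forall n, (2 <= n <= N)%N ->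
     alpha_n rho b D n = alpha /\ theta_n b n = theta) ->
  forall ell : {scalar Feps}, continuous (ell : Feps -> R) ->
  spsd_functional tF ell ->
  forall U : Epi, tensor_sub tE (Ek N e) (Ek N e) U ->
  (forall z, tensor_sub tF (Fk N t) (Fk N t) z ->
     B U z - rho ^+ 2 * Delta U z = ell z) ->
  `|U| <= stability_constant N (infsup (@bform R lambda T) (Ek N e) (Fk N t))
            alpha beta theta * dual_norm ell.
Proof.
move=> b D beta_pos betaE alphaE ell cell [ell_sym ell_ge0] U U_Ek U_eq.
have [t0 tN _] := t_mesh.
case: N => [|M] in t_mesh v_hat e_trial gamma_gt0 Delta_spsd Delta_sparse t_uniform
  e_scaled beta_pos betaE alphaE U_Ek U_eq t0 tN *.
  by have := lt_irreflexive T; rewrite -{1}tN t0 T_gt0.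
pose e' n := e n.+1.
have A_span := Ek_span M.+1 e.
have F_span := Fk_span t_mesh (ltW T_gt0) v_hat.
have beta_gt0 : 0 < beta by rewrite -(betaE 1%N)// beta_pos.
have orth c := trial_orthonormal t_mesh e_trial c e_scaled.1.
have spsd m : (m < M.+1)%N -> spsd_tensor tE (tE (e' m) (e' m)) /\
    tensor_sub tE (Ek M.+1 e) (Ek M.+1 e) (tE (e' m) (e' m)).
  move=> mM; split; first exact: elementary_square_spsd.
  have Ae : Ek M.+1 e (e' m) by rewrite A_span; exact: (test_basis (v := e') erefl).
  exists [:: (e' m, e' m)]; last by rewrite /tsum big_seq1.
  by move=> p; rewrite inE => /eqP ->.
have [c UE] := tensor_sub_coef (e := e') A_span U_Ek.
rewrite stability_constant_geometric UE.
apply: (@solution_bound R _ _ _ _ tE tF tE_projective tF_injective _ B B_elementary M e' v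
  (Ek M.+1 e) (Fk M.+1 t) orth A_span F_span _ gamma_gt0 Delta _ _ _ _ rho) => //.
- by move=> m i mM iM; exact: (bform_hat_eq0 t_mesh e_trial v_hat).
- move=> m y z mM Fy Fz; have [h1 h2] := spsd m mM.
  exact: (Delta_spsd _ h2 h1 _ _ Fy Fz).1.
- move=> m y mM Fy; have [h1 h2] := spsd m mM.
  exact: (Delta_spsd _ h2 h1 _ _ Fy Fy).2.
- move=> m i j mM iM jM /Delta_sparse; rewrite !inE => -[] //=; lia.
- move=> m n i j mM nM iM jM mn; apply/eqP/negP => /negP /Delta_sparse -[]// /eqP.
  by rewrite eqSS (negbTE mn).
- by move=> n nM; rewrite -(betaE n.+1)// invrK.
- by move=> n nM; have [|_ <-] := alphaE n.+2; [|rewrite mulrC].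
- by move=> n nM; have [|<- <-] := alphaE n.+2; [|rewrite /alpha_n betaE].
- move=> y z Fy Fz; rewrite -UE; apply: U_eq.
  exists [:: (y, z)]; last by rewrite /tsum big_seq1.
  by move=> p; rewrite inE => /eqP ->.
Qed.
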